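(* Let $S$ be a locally compact Hausdorff topological semigroup. If the sets $FK^{-1}$ and $K^{-1}F$ are relatively compact for all compact subsets $F$ and $K$ of $S$, then the measure algebra $M_b(S)$ is a dual Banach algebra with respect to the predual $C_0(S)$.
   Context: A topological semigroup is a semigroup with a topology for which multiplication $S\times S\to S$ is (jointly) continuous. For $F,K\subseteq S$ and $s\in S$: $s^{-1}F=\{t\in S: st\in F\}$, $Fs^{-1}=\{t\in S: ts\in F\}$, $FK^{-1}=\bigcup_{s\in K}Fs^{-1}$, $K^{-1}F=\bigcup_{s\in K}s^{-1}F$. $C_0(S)$ is the Banach space of continuous functions on $S$ vanishing at infinity. $M_b(S)$ is the space of bounded Radon measures on $S$, identified with $C_0(S)^*$ via $\langle\mu,f\rangle=\int_S f\,d\mu$; it is a Banach algebra under convolution $(\mu*\nu)(f)=\int_S\int_S f(st)\,d\mu(s)\,d\nu(t)$ ($f\in C_0(S)$). For a Banach algebra $\mathfrak A$, the module actions on $\mathfrak A^*$ are $\langle f\cdot a,b\rangle=\langle f,ab\rangle$ and $\langle a\cdot f,b\rangle=\langle f,ba\rangle$ ($a,b\in\mathfrak A$, $f\in\mathfrak A^*$). A Banach algebra $\mathfrak A$ that is a dual Banach space with predual $\mathfrak A_*$ (regarded as a closed subspace of $\mathfrak A^*$) is a dual Banach algebra with predual $\mathfrak A_*$ if $a\cdot f\in\mathfrak A_*$ and $f\cdot a\in\mathfrak A_*$ for all $a\in\mathfrak A$, $f\in\mathfrak A_*$ (equivalently, multiplication in $\mathfrak A$ is separately $\sigma(\mathfrak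 A,\mathfrak A_* )$-continuous). *)

(* Defs.v *)
From HB Require Import structures.
From mathcomp Require Import all_boot all_order all_algebra.
From mathcomp Require Import all_classical all_reals all_analysis.
From mathcomp Require Import complex.

Set Implicit Arguments.
Unset Strict Implicit.
Unset Printing Implicit Defensive.

Import Order.TTheory GRing.Theory Num.Theory.
Import numFieldNormedType.Exports.
Import Normc.

Local Open Scope classical_set_scope.
Local Open Scope ring_scope.
Local Open Scope complex_scope.

HB.mixin Record isTopologicalSemigroup S
    & PointedTopological S & Semigroup S := {
  mulg_continuous : continuous (fun p : S * S => (p.1 * p.2)%g)
}.

#[short(type="topologicalSemigroupType")]
HB.structure Definition TopologicalSemigroup :=
  {S of PointedTopological S & Semigroup S & isTopologicalSemigroup S}.

Section semigroup_quotients.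
Context (S : semigroupType).

(** $F K^{-1} = \bigcup_{s \in K} \{t : ts \in F\}$ *)
Definition set_divr (F K : set S) : set S :=
  \bigcup_(s in K) [set t | F (t * s)%g].

(** $K^{-1} F = \bigcup_{s \in K} \{t : st \in F\}$ *)
Definition set_divl (K F : set S) : set S :=
  \bigcup_(s in K) [set t | F (s * t)%g].

End semigroup_quotients.

Section complex_continuity.
Context (R : realType).
Local Notation C := R[i]^o.

Lemma ler_Re_normc (z : C) : `|complex.Re z| <= normc z.
Proof. by have := normc_ge_Re z; rewrite lecR. Qed.

Lemma ler_Im_normc (z : C) : `|complex.Im z| <= normc z.
Proof.
case: z => a b /=; rewrite -sqrtr_sqr ler_wsqrtr// lerDr sqr_ge0//.
Qed.

Lemma normcB_le (x y : C) : `|normc x - normc y| <= normc (x - y).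
Proof.
rewrite ler_norml; apply/andP; split.
  by rewrite lerNl opprB -(normcN (x - y)) opprB -lecR rmorphB/=;
    exact: (@lerB_dist R[i] R[i]).
by rewrite -lecR rmorphB/=; exact: (@lerB_dist R[i] R[i]).
Qed.

Lemma lipschitz1_continuous (h : C -> R) :
  (forall x y, `|h x - h y| <= normc (x - y)) -> continuous h.
Proof.
move=> hl x; apply/(@cvgrPdist_lt R R^o C (nbhs x) (nbhs_filter x)) => e e0.
have : nbhs x [set t : C | `|x - t| < e%:C].
  by rewrite -nbhs_ballE; exists e%:C => //=; rewrite ltcR.
by apply: (@filterS C (nbhs x)) => t /=; rewrite ltcR; exact: le_lt_trans.
Qed.

Lemma normc_continuous : continuous (@normc R : C -> R).
Proof. exact/lipschitz1_continuous/normcB_le. Qed.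

Lemma Re_continuous : continuous (@complex.Re R : C -> R).
Proof.
by apply: lipschitz1_continuous => x y; rewrite -raddfB; exact: ler_Re_normc.
Qed.

Lemma Im_continuous : continuous (@complex.Im R : C -> R).
Proof.
by apply: lipschitz1_continuous => x y; rewrite -raddfB; exact: ler_Im_normc.
Qed.

End complex_continuity.

Section C0.
Context (R : realType) (S : ptopologicalType).
Local Notation C := R[i]^o.

(** [normc] is the real-valued modulus: [`|z| = (normc z)%:C]. *)
Definition vanishes_at_infinity (f : S -> C) :=
  forall e : R, 0 < e -> compact [set x | e <= normc (f x)].

Definition C0_pred : {pred S -> C} :=
  [pred f | `[< continuous f /\ vanishes_at_infinity f >]].

Lemma closed_normc_ge (f : S -> C) (e : R) : continuous f ->
  closed [set x | e <= normc (f x)].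
Proof.
move=> cf; apply: (@closed_comp _ _ (fun x => normc (f x)) [set y | e <= y]).
  by move=> x _; apply: continuous_comp; [exact: cf|exact: normc_continuous].
exact: closed_ge.
Qed.

Lemma C0_submod_closed : submod_closed C0_pred.
Proof.
split.
  apply/asboolP; split; first exact: cst_continuous.
  move=> e e0; rewrite (_ : [set _ | _] = set0); first exact: compact0.
  rewrite -subset0 => x /=.
  by rewrite expr0n addr0 sqrtr0 leNgt e0.
move=> a f g /asboolP[cf vf] /asboolP[cg vg]; apply/asboolP.
have cfg : continuous (a *: f + g).
  move=> x.
  by apply: (@cvgD _ C _ _ _ (fun y => a *: f y) g);
    [apply: cvgZr; exact: cf|exact: cg].
split => // e e0.
have na0 : 0 <= normc a by have := normr_ge0 a; rewrite lecR.
have d0 : 0 < 1 + normc a by rewrite ltr_pwDl.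
have e20 : 0 < e / 2 by rewrite divr_gt0.
apply: (@subclosed_compact _ _ ([set x | e / 2 / (1 + normc a) <= normc (f x)]
    `|` [set x | e / 2 <= normc (g x)])).
- exact: closed_normc_ge.
- by apply: compactU; [apply: vf; rewrite divr_gt0|exact: vg].
- move=> x /= ex; have [|gx] := leP (e / 2) (normc (g x)); first by right.
  left; rewrite ler_pdivrMr// leNgt; apply/negP => fx.
  move: ex; rewrite leNgt => /negP; apply.
  apply: (@le_lt_trans _ _ (normc (a * f x) + normc (g x))).
    exact: le_normcD.
  rewrite (splitr e) ltrD// (le_lt_trans _ fx)// normcM mulrC ler_wpM2l//.
    by have := normr_ge0 (f x); rewrite lecR.
  by rewrite lerDr.
Qed.

HB.instance Definition _ := GRing.isSubmodClosed.Build _ _ C0_pred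
  C0_submod_closed.

Record C0 := MkC0 { C0_fun :> S -> C ; C0_funP : C0_fun \in C0_pred }.

HB.instance Definition _ := [isSub for C0_fun].
HB.instance Definition _ := [Choice of C0 by <:].
HB.instance Definition _ := [SubChoice_isSubLmodule of C0 by <:].

Definition C0_norm (f : C0) : R[i] := (sup [set normc (f x) | x in [set: S]])%:C.

Lemma C0_has_sup (f : C0) : has_sup [set normc (f x) | x in [set: S]].
Proof.
have /asboolP[cf vf] := C0_funP f.
split; first by exists (normc (f point)); exists point.
have cn : continuous (fun x => normc (f x)).
  by move=> x; apply: continuous_comp; [exact: cf|exact: normc_continuous].
have /(@compact_bounded R R^o)[M [_ /(_ (M + 1))]] :=
  continuous_compact (continuous_subspaceT cn) (vf 1 ltr01).
rewrite ltrDl ltr01 => /(_ isT) bM.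
exists (Num.max 1 (M + 1)) => _ [x _ <-] /=; rewrite le_max.
have [//|f1] := leP (normc (f x)) 1; apply/orP; right.
by apply: le_trans (ler_norm _) (bM _ _); exists x => //=; exact: ltW.
Qed.

Lemma C0_normcP (f : C0) x : normc (f x) <= sup [set normc (f x) | x in [set: S]].
Proof. by apply: sup_ubound; [exact: (C0_has_sup f).2|exists x]. Qed.

Lemma C0_norm_le (f : C0) (M : R) : (forall x, normc (f x) <= M) ->
  sup [set normc (f x) | x in [set: S]] <= M.
Proof.
by move=> fM; apply: sup_le_ub; [exact: (C0_has_sup f).1|move=> _ [x _ <-]].
Qed.

Lemma C0_normD f g : C0_norm (f + g) <= C0_norm f + C0_norm g.
Proof.
rewrite /C0_norm -rmorphD lecR; apply: C0_norm_le => x.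
exact: le_trans (le_normcD _ _) (lerD (C0_normcP f x) (C0_normcP g x)).
Qed.

Lemma C0_normZ (a : R[i]) f : C0_norm (a *: f) = `|a| * C0_norm f.
Proof.
rewrite /C0_norm [X in X * _](_ : _ = (normc a)%:C)// -rmorphM; congr (_%:C).
have na0 : 0 <= normc a by have := normr_ge0 a; rewrite lecR.
apply/eqP; rewrite eq_le; apply/andP; split.
  by apply: C0_norm_le => x; rewrite normcM ler_wpM2l// C0_normcP.
have [->|a0] := eqVneq a 0.
  rewrite normc0 mul0r; apply: le_trans (C0_normcP _ point).
  by have := normr_ge0 ((0 *: f : C0) point); rewrite lecR.
have {}na0 : 0 < normc a.
  rewrite lt_neqAle na0 andbT eq_sym; apply/eqP => /eq0_normc a0'.
  by rewrite a0' eqxx in a0.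
rewrite mulrC -ler_pdivlMr//; apply: C0_norm_le => x.
rewrite ler_pdivlMr// mulrC -normcM.
exact: (C0_normcP (a *: f) x).
Qed.

Lemma C0_norm0_eq0 f : C0_norm f = 0 -> f = 0.
Proof.
move=> [f0]; apply/val_inj/funext => x; apply: eq0_normc.
apply/eqP; rewrite eq_le -{1}f0 C0_normcP.
by have := normr_ge0 (f x); rewrite lecR.
Qed.

HB.instance Definition _ :=
  Lmodule_isNormed.Build R[i] C0 C0_normD C0_normZ C0_norm0_eq0.

End C0.

Notation borel S := (g_sigma_algebraType (@open S)).

Section Mb.
Context (R : realType) (S : ptopologicalType).
Local Notation C := R[i]^o.

(** The families range over measurable subsets of [A]; for measurable [A] this is
    the supremum over finite measurable partitions of [A]. *)
Definition total_variation (mu : set (borel S) -> C) (A : set S) : \bar R :=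
  ereal_sup [set (\sum_(i < n) normc (mu (B i)))%:E | n in [set: nat] &
    B in [set B : (set (borel S))^nat | trivIset setT B /\
      forall i, measurable (B i) /\ B i `<=` A]].

(** A complex Borel measure is a function on all sets that vanishes outside the
    Borel sets, so that equality of functions is equality of measures. *)
Record is_radon (mu : set (borel S) -> C) : Prop := {
  radon_sigma_additive : forall F : (set (borel S))^nat,
    (forall i, measurable (F i)) -> trivIset setT F ->
    (fun n => \sum_(0 <= i < n) mu (F i)) @ \oo --> mu (\bigcup_i F i) ;
  radon_bounded : (total_variation mu setT < +oo)%E ;
  radon_regular : forall (A : set (borel S)) (e : R),
    measurable A -> 0 < e -> exists K : set S,
      [/\ compact K, K `<=` A & (total_variation mu (A `\` K) < e%:E)%E] ;
  radon_nonmeasurable : forall A, ~ measurable A -> mu A = 0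
}.

Lemma tv_le (mu : set (borel S) -> C) A (M : \bar R) :
  (forall n (B : (set (borel S))^nat), trivIset setT B ->
    (forall i, measurable (B i)) -> (forall i, B i `<=` A) ->
    (\sum_(i < n) normc (mu (B i)))%:E <= M)%E ->
  (total_variation mu A <= M)%E.
Proof.
by move=> H; apply: ge_ereal_sup => _ [n _ [B [tB mB] <-]]; apply: H => // i;
  case: (mB i).
Qed.

Lemma tv_ge (mu : set (borel S) -> C) A n (B : (set (borel S))^nat) :
  trivIset setT B ->
    (forall i, measurable (B i)) -> (forall i, B i `<=` A) ->
    ((\sum_(i < n) normc (mu (B i)))%:E <= total_variation mu A)%E.
Proof.
by move=> tB mB BA; apply: ereal_sup_ubound; exists n => //; exists B.
Qed.

Lemma tv_ge0 mu A : (0 <= total_variation mu A)%E.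
Proof.
have := @tv_ge mu A 0%N (fun=> set0).
by rewrite big_ord0; apply; [exact: trivIset_set0|by move=> _|by move=> _].
Qed.

Lemma tv_subset mu A B : A `<=` B ->
  (total_variation mu A <= total_variation mu B)%E.
Proof.
move=> AB; apply: tv_le => n F tF mF FA; apply: tv_ge => // i.
exact: subset_trans (FA i) AB.
Qed.

Lemma normc_ge0 (z : C) : 0 <= normc z.
Proof. by have := normr_ge0 z; rewrite lecR. Qed.

Lemma tv_lin (a : R[i]) (mu nu : set (borel S) -> C) A :
  (total_variation (a *: mu + nu)%R A <=
   (normc a)%:E * total_variation mu A + total_variation nu A)%E.
Proof.
apply: tv_le => n B tB mB BA.
apply: (@le_trans _ _ ((\sum_(i < n) (normc a * normc (mu (B i)))
   + \sum_(i < n) normc (nu (B i)))%:E)).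
  rewrite lee_fin -big_split; apply: ler_sum => i _ /=.
  by rewrite -normcM; exact: le_normcD.
rewrite EFinD leeD ?tv_ge// -mulr_sumr EFinM lee_wpmul2l ?tv_ge//.
by rewrite lee_fin normc_ge0.
Qed.

Definition Mb_pred : {pred set (borel S) -> C} := [pred mu | `[< is_radon mu >]].

Lemma Mb_submod_closed : submod_closed Mb_pred.
Proof.
split.
  have tv0 A : total_variation 0 A = 0%E.
    apply/eqP; rewrite eq_le tv_ge0 andbT; apply: tv_le => n B _ _ _.
    by rewrite lee_fin big1// => i _; rewrite normc0.
  apply/asboolP; split => //.
  - move=> F mF tF; under eq_fun do rewrite big1//; exact: cvg_cst.
  - by rewrite tv0.
  - by move=> A e mA e0; exists set0; split; rewrite ?tv0//; exact: compact0.
move=> a mu nu /asboolP[smu bmu rmu nmu] /asboolP[snu bnu rnu nnu].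
apply/asboolP; split.
- move=> F mF tF; under eq_fun.
    move=> n; rewrite (_ : \sum_(0 <= i < n) _ =
      a *: (\sum_(0 <= i < n) mu (F i)) + \sum_(0 <= i < n) nu (F i)).
      over.
    by rewrite scaler_sumr -big_split.
  by apply: (@cvgD _ C); [apply: cvgZr; exact: smu|exact: snu].
- apply: le_lt_trans (tv_lin _ _ _ _) _; rewrite lte_add_pinfty//.
  by rewrite lte_mul_pinfty// lee_fin normc_ge0.
- move=> A e mA e0.
  have d0 : 0 < 1 + normc a by rewrite ltr_pwDl// normc_ge0.
  have e20 : 0 < e / 2 by rewrite divr_gt0.
  have [K [cK KA vK]] := rmu A (e / 2 / (1 + normc a)) mA (divr_gt0 e20 d0).
  have [L [cL LA vL]] := rnu A (e / 2) mA e20.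
  exists (K `|` L); split; [exact: compactU|by rewrite subUset|].
  apply: le_lt_trans (tv_lin _ _ _ _) _.
  have muK : (total_variation mu (A `\` (K `|` L)) <=
      (e / 2 / (1 + normc a))%:E)%E.
    apply/ltW; apply: le_lt_trans vK; apply: tv_subset.
    by apply: setDS; exact: subsetUl.
  have nuL : (total_variation nu (A `\` (K `|` L)) < (e / 2)%:E)%E.
    apply: le_lt_trans vL; apply: tv_subset.
    by apply: setDS; exact: subsetUr.
  apply: (@le_lt_trans _ _
    ((e / 2)%:E + total_variation nu (A `\` (K `|` L)))%E).
    rewrite leeD2r//; apply: (@le_trans _ _
      ((normc a)%:E * (e / 2 / (1 + normc a))%:E)%E).
      by rewrite lee_wpmul2l ?lee_fin ?normc_ge0.
    rewrite -EFinM lee_fin mulrC mulrAC ler_pdivrMr//.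
    by rewrite ler_wpM2l ?(ltW e20)// lerDr.
  by rewrite [X in (_ < X%:E)%E](splitr e) EFinD lteD2lE.
- by move=> A mA; rewrite -[LHS]/(a * mu A + nu A) nmu// nnu// mulr0 addr0.
Qed.

HB.instance Definition _ := GRing.isSubmodClosed.Build _ _ Mb_pred
  Mb_submod_closed.

Record Mb := MkMb {
  Mb_fun :> set (borel S) -> C ; Mb_funP : Mb_fun \in Mb_pred }.

HB.instance Definition _ := [isSub for Mb_fun].
HB.instance Definition _ := [Choice of Mb by <:].
HB.instance Definition _ := [SubChoice_isSubLmodule of Mb by <:].

Lemma Mb_radon (mu : Mb) : is_radon mu.
Proof. exact/asboolP/(Mb_funP mu). Qed.

Definition Mb_norm (mu : Mb) : R[i] := (fine (total_variation mu setT))%:C.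

Lemma tv_fin_num (mu : Mb) : total_variation mu setT \is a fin_num.
Proof. by rewrite ge0_fin_numE ?tv_ge0//; exact: radon_bounded (Mb_radon mu). Qed.

Lemma tvZ_le (a : R[i]) (mu : set (borel S) -> C) :
  (total_variation (a *: mu)%R setT <= (normc a)%:E * total_variation mu setT)%E.
Proof.
apply: tv_le => n B tB mB BA.
rewrite (eq_bigr (fun i : 'I_n => normc a * normc (mu (B i)))) => [|i _].
  by rewrite -mulr_sumr EFinM lee_wpmul2l ?tv_ge// lee_fin normc_ge0.
by rewrite -normcM.
Qed.

Lemma Mb_normD mu nu : Mb_norm (mu + nu) <= Mb_norm mu + Mb_norm nu.
Proof.
rewrite /Mb_norm -rmorphD lecR -lee_fin EFinD !fineK ?tv_fin_num//.
have := tv_lin 1 (mu : set (borel S) -> C) (nu : set (borel S) -> C) setT.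
by rewrite scale1r normc1 mul1e.
Qed.

Lemma Mb_normZ (a : R[i]) mu : Mb_norm (a *: mu) = `|a| * Mb_norm mu.
Proof.
rewrite /Mb_norm [X in X * _](_ : _ = (normc a)%:C)// -rmorphM; congr (_%:C).
have le1 b (nu : Mb) : fine (total_variation (b *: nu : Mb) setT) <=
    normc b * fine (total_variation nu setT).
  rewrite -lee_fin EFinM !fineK ?tv_fin_num//.
  exact: tvZ_le.
apply/eqP; rewrite eq_le le1 /=.
have [->|a0] := eqVneq a 0.
  by rewrite normc0 mul0r fine_ge0// tv_ge0.
have {}na0 : 0 < normc a.
  rewrite lt_neqAle normc_ge0 andbT eq_sym; apply/eqP => /eq0_normc a0'.
  by rewrite a0' eqxx in a0.
have := le1 a^-1 (a *: mu).
rewrite scalerA mulVf// scale1r normcV => H.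
by rewrite -ler_pdivlMl.
Qed.

Lemma Mb_norm0_eq0 mu : Mb_norm mu = 0 -> mu = 0.
Proof.
move=> [mu0]; apply/val_inj/funext => A.
suff : normc (mu A) = 0 by exact: eq0_normc.
have [mA|nmA] := pselect (measurable A); last first.
  by rewrite (radon_nonmeasurable (Mb_radon mu) nmA) normc0.
apply/eqP; rewrite eq_le normc_ge0 andbT -{1}mu0 -lee_fin fineK ?tv_fin_num//.
have := @tv_ge mu setT 1%N (fun i => if i is 0%N then A else set0).
rewrite big_ord1; apply => //; last by case.
by apply/trivIsetP => -[|i] [|j]//= _ _ _; rewrite ?setI0 ?set0I.
Qed.

HB.instance Definition _ :=
  Lmodule_isNormed.Build R[i] Mb Mb_normD Mb_normZ Mb_norm0_eq0.

End Mb.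

Section integral.
Context (R : realType) (S : ptopologicalType).
Local Notation C := R[i]^o.

Section real_imaginary_charges.
Variable mu : Mb R S.

Definition Re_charge (A : set (borel S)) : \bar R := (complex.Re (mu A))%:E.
Definition Im_charge (A : set (borel S)) : \bar R := (complex.Im (mu A))%:E.

Lemma Mb_set0 : mu set0 = 0.
Proof.
have := @radon_sigma_additive _ _ _ (Mb_radon mu) (fun=> set0)
  (fun=> measurable0) (@trivIset_set0 _ _ _).
move=> /cvgP /(@cvg_series_cvg_0 R[i] C (fun=> mu set0)) mu0.
exact: (@cvg_unique C (@norm_hausdorff _ _) _ _ _ _ (cvg_cst _) mu0).
Qed.

Let sigma_additive_part (p : {additive C -> R}) : continuous (p : C -> R) ->
  semi_sigma_additive (fun A : set (borel S) => (p (mu A))%:E).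
Proof.
move=> cp F mF tF _.
rewrite (_ : (fun n => _) =
    EFin \o (fun n => p (\sum_(0 <= i < n) mu (F i)))); last first.
  by apply/funext => n /=; rewrite raddf_sum sumEFin.
apply: cvg_EFin; first exact: nearW.
apply: continuous_cvg; first exact: cp.
exact: (radon_sigma_additive (Mb_radon mu)) mF tF.
Qed.

Let Re_charge0 : Re_charge set0 = 0%E.
Proof. by rewrite /Re_charge Mb_set0. Qed.
Let Re_charge_fin A : measurable A -> Re_charge A \is a fin_num.
Proof. by []. Qed.
Let Re_charge_sigma_additive : semi_sigma_additive Re_charge.
Proof. exact: (sigma_additive_part (@Re_continuous R)). Qed.
HB.instance Definition _ := isCharge.Build _ _ _ Re_charge
  Re_charge0 Re_charge_fin Re_charge_sigma_additive.

Let Im_charge0 : Im_charge set0 = 0%E.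
Proof. by rewrite /Im_charge Mb_set0. Qed.
Let Im_charge_fin A : measurable A -> Im_charge A \is a fin_num.
Proof. by []. Qed.
Let Im_charge_sigma_additive : semi_sigma_additive Im_charge.
Proof. exact: (sigma_additive_part (@Im_continuous R)). Qed.
HB.instance Definition _ := isCharge.Build _ _ _ Im_charge
  Im_charge0 Im_charge_fin Im_charge_sigma_additive.

End real_imaginary_charges.

Definition hahn d (T : measurableType d) (nu : {charge set T -> \bar R}) :
  {PN : set T * set T | hahn_decomposition nu PN.1 PN.2}.
Proof.
by apply: cid; have [P [N PN]] := Hahn_decomposition nu; exists (P, N).
Qed.

(** By uniqueness of the Jordan decomposition, this does not depend on the Hahn
    decomposition chosen. *)
Definition charge_integral d (T : measurableType d)
    (nu : {charge set T -> \bar R}) (f : T -> R) : R :=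
  \int[jordan_pos (svalP (hahn nu))]_x f x -
  \int[jordan_neg (svalP (hahn nu))]_x f x.

(** $\int f\,d\mu$ expanded along $f = \Re f + i \Im f$ and
    $\mu = \Re\mu + i \Im\mu$. *)
Definition Mb_integral (mu : Mb R S) (f : S -> C) : C :=
  (charge_integral (Re_charge mu) (fun x => complex.Re (f x)) -
   charge_integral (Im_charge mu) (fun x => complex.Im (f x))) +i*
  (charge_integral (Re_charge mu) (fun x => complex.Im (f x)) +
   charge_integral (Im_charge mu) (fun x => complex.Re (f x))).

End integral.

Section convolution.
Context (R : realType) (S : topologicalSemigroupType).

Definition is_convolution (mu nu lambda : Mb R S) : Prop :=
  forall f : C0 R S, Mb_integral lambda f =
    Mb_integral nu (fun t => Mb_integral mu (fun s => f (s * t)%g)).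

End convolution.

Section dual_Banach_algebra.
Context (K : numFieldType).

Definition is_complete (V : normedModType K) : Prop :=
  forall F : set_system V, ProperFilter F -> cauchy F -> cvg F.

Record is_Banach_algebra (A : normedModType K) (mul : A -> A -> A) : Prop := {
  Banach_complete : is_complete A ;
  Banach_mulA : associative mul ;
  Banach_linearl : forall b, linear (mul^~ b) ;
  Banach_linearr : forall a, linear (mul a) ;
  Banach_norm_mul : forall a b, `|mul a b| <= `|a| * `|b|
}.

(** [pair] identifies [A] isometrically with the dual of [P]: by
    [predual_isometry], [`|a|] is the operator norm of [pair a]. *)
Record is_predual (A P : normedModType K) (pair : A -> P -> K^o) : Prop := {
  predual_complete : is_complete P ;
  predual_linearl : forall p, linear (pair^~ p) ;
  predual_linearr : forall a, linear (pair a) ;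
  predual_isometry : forall a (M : K), 0 <= M ->
    `|a| <= M <-> forall p, `|pair a p| <= M * `|p| ;
  predual_surjective : forall phi : P -> K^o,
    linear phi -> continuous phi -> exists a, pair a = phi
}.

Definition left_action (A : Type) (mul : A -> A -> A) (a : A) (f : A -> K^o) :=
  fun b => f (mul b a).

Definition right_action (A : Type) (mul : A -> A -> A) (f : A -> K^o) (a : A) :=
  fun b => f (mul a b).

(** [P] seen as a space of functionals on [A]. *)
Definition predual_functionals (A P : Type) (pair : A -> P -> K^o) :
  set (A -> K^o) := [set pair^~ p | p in [set: P]].

Record is_dual_Banach_algebra (A P : normedModType K) (mul : A -> A -> A)
    (pair : A -> P -> K^o) : Prop := {
  dual_Banach_algebra : is_Banach_algebra mul ;
  dual_predual : is_predual pair ;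
  dual_left_action : forall a f, predual_functionals pair f ->
    predual_functionals pair (left_action mul a f) ;
  dual_right_action : forall a f, predual_functionals pair f ->
    predual_functionals pair (right_action mul f a)
}.

End dual_Banach_algebra.

(* Main.v *)
(** The proof rests on the Riesz representation theorem: [Mb R S] is isometric to
    the dual of [C0 R S]. A positive functional gives a content on open sets, then
    a Caratheodory outer measure, and the layer-cake formula recovers the
    functional; a complex functional splits into four positive ones. Bounds with
    the sharp constant, the total variation, follow from approximation by step
    functions and, in the other direction, from Lusin's argument.

    For [f] in [C0], the average [F t] of [f (s * t)] over [mu] in [s] is
    continuous because [mu] is almost carried by a compact [K], and vanishes at
    infinity because [|f (s * t)| >= e] for some [s] in [K] forces [t] into
    [K^-1 {|f| >= e}]. So [f |-> \int F dnu] is a functional on [C0] and defines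
    the convolution of [mu] and [nu]; associativity needs no interchange of
    integrals. One module action is given by [F] itself, and the other one by the
    average in [t], after Fubini's theorem. *)

Require Import Defs.
From HB Require Import structures.
From mathcomp Require Import all_boot all_order all_algebra.
From mathcomp Require Import all_classical all_reals all_analysis.
From mathcomp Require Import measurable_realfun finmap complex.
From mathcomp Require Import ring lra.

Set Implicit Arguments.
Unset Strict Implicit.
Unset Printing Implicit Defensive.

Import Order.TTheory GRing.Theory Num.Theory.
Import numFieldNormedType.Exports.
Import Normc.

Local Open Scope classical_set_scope.
Local Open Scope ring_scope.

(** * Urysohn functions on a locally compact space *)

(** [Mb_integral] is built from Hahn decompositions of the real and imaginary parts, while the norm
    of [Mb] is a supremum over finite disjoint families. Bounding the parts separately loses a
    constant factor, and different measures have unrelated decompositions, so neither the sharp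
    bound nor linearity in the measure is formal. Both go through step functions, whose integral is
    a finite sum of values of the measure; the crude bound only controls errors that are made
    arbitrarily small. The Riesz construction loses factors too, since a real functional of bound
    [B] splits into parts of bounds [B] and [2B]. This is harmless: it serves for existence, and the
    norm of a measure is read off afterwards from the functional that it defines. Each quotient
    condition serves one of the two averages: $K^{-1}F$ the one over $s$, $FK^{-1}$ the one over
    $t$. The second, with $K$ a point, also puts $s \mapsto f(st)$ in $C_0(S)$. *)

Lemma ler_dist_itv (R : realDomainType) (a b x y : R) :
  a <= x <= b -> a <= y <= b -> `|x - y| <= b - a.
Proof.
move=> /andP[ax xb] /andP[ay yb]; rewrite ler_norml; apply/andP; split.
  by rewrite opprB lerB.
exact: lerB.
Qed.

Section real_continuity.
Context (R : realType) (T : topologicalType).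
Implicit Types f g : T -> R.

Lemma continuous_addf f g :
  continuous f -> continuous g -> continuous (fun x => f x + g x).
Proof. by move=> cf cg x; apply: cvgD; [exact: cf|exact: cg]. Qed.

Lemma continuous_subf f g :
  continuous f -> continuous g -> continuous (fun x => f x - g x).
Proof. by move=> cf cg x; apply: cvgB; [exact: cf|exact: cg]. Qed.

Lemma continuous_mulf f g :
  continuous f -> continuous g -> continuous (fun x => f x * g x).
Proof. by move=> cf cg x; apply: cvgM; [exact: cf|exact: cg]. Qed.

Lemma continuous_minf f g :
  continuous f -> continuous g -> continuous (fun x => Num.min (f x) (g x)).
Proof. by move=> cf cg x; apply: continuous_min; [exact: cf|exact: cg]. Qed.

Lemma continuous_maxf f g :
  continuous f -> continuous g -> continuous (fun x => Num.max (f x) (g x)).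
Proof. by move=> cf cg x; apply: continuous_max; [exact: cf|exact: cg]. Qed.

Lemma continuous_sumf (I : Type) (s : seq I) (F : I -> T -> R) :
  (forall i, continuous (F i)) -> continuous (fun x => \sum_(i <- s) F i x).
Proof.
move=> cF; elim: s => [|i s IH].
  by under eq_fun do rewrite big_nil; exact: cst_continuous.
by under eq_fun do rewrite big_cons; exact: continuous_addf.
Qed.

Lemma closed_gef f (e : R) : continuous f -> closed [set x | e <= f x].
Proof.
by move=> cf; apply: (@closed_comp _ _ f [set y | e <= y]) => //; exact: closed_ge.
Qed.

Lemma open_gtf f (e : R) : continuous f -> open [set x | e < f x].
Proof.
by move=> cf; apply: (@open_comp _ _ f [set y | e < y]) => //; exact: open_gt.
Qed.

End real_continuity.

(** Positive functionals are defined on this cone of plain real functions, which is stable under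
    minima, truncation and multiplication by cutoffs; it is not a vector space, so a difference
    [f - g] requires [g <= f]. *)
Record C0nneg (R : realType) (S : topologicalType) (f : S -> R) : Prop := {
  C0nneg_continuous : continuous f ;
  C0nneg_ge0 : forall x, 0 <= f x ;
  C0nneg_compact : forall e : R, 0 < e -> compact [set x | e <= f x]
}.

Section C0nneg_theory.
Context (R : realType) (S : topologicalType).
Implicit Types f g : S -> R.

Lemma C0nneg_dominated f g : continuous g -> (forall x, 0 <= g x <= f x) ->
  C0nneg f -> C0nneg g.
Proof.
move=> cg gf [cf f0 vf]; split=> // [x|e e0]; first by case/andP: (gf x).
apply: (subclosed_compact (closed_gef cg) (vf e e0)) => x /= /le_trans; apply.
by case/andP: (gf x).
Qed.

Lemma C0nneg0 : @C0nneg R S (fun=> 0).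
Proof.
split=> [||e e0] //; first exact: cst_continuous.
rewrite (_ : [set _ | _] = set0); first exact: compact0.
by rewrite -subset0 => x /=; rewrite leNgt e0.
Qed.

Lemma C0nnegD f g : C0nneg f -> C0nneg g -> C0nneg (fun x => f x + g x).
Proof.
move=> [cf f0 vf] [cg g0 vg]; split => [|x|e e0].
- exact: continuous_addf.
- exact: addr_ge0.
- have e20 : 0 < e / 2 by rewrite divr_gt0.
  apply: (subclosed_compact (closed_gef (continuous_addf cf cg))
    (compactU (vf _ e20) (vg _ e20))) => x /= efg.
  have [|fx] := leP (e / 2) (f x); first by left.
  have [|gx] := leP (e / 2) (g x); first by right.
  by move: efg; rewrite leNgt (splitr e) ltrD.
Qed.

Lemma C0nneg_mull (h : S -> R) f : continuous h -> (forall x, 0 <= h x <= 1) ->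
  C0nneg f -> C0nneg (fun x => h x * f x).
Proof.
move=> ch h01 /[dup] Cf [cf f0 _]; apply: C0nneg_dominated Cf.
  exact: continuous_mulf.
by move=> x; have /andP[h0 h1] := h01 x; rewrite mulr_ge0//= ler_piMl.
Qed.

Lemma C0nneg_min f g : C0nneg f -> C0nneg g ->
  C0nneg (fun x => Num.min (f x) (g x)).
Proof.
move=> /[dup] Cf [cf f0 _] [cg g0 _]; apply: C0nneg_dominated Cf.
  exact: continuous_minf.
by move=> x; rewrite le_min f0 g0/= ge_min lexx.
Qed.

Lemma C0nneg_min_cst f (c : R) : 0 <= c -> C0nneg f ->
  C0nneg (fun x => Num.min (f x) c).
Proof.
move=> c0 /[dup] Cf [cf f0 _]; apply: C0nneg_dominated Cf.
  by apply: continuous_minf => //; exact: cst_continuous.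
by move=> x; rewrite le_min f0 c0/= ge_min lexx.
Qed.

Lemma C0nneg_sub f g : C0nneg f -> C0nneg g -> (forall x, g x <= f x) ->
  C0nneg (fun x => f x - g x).
Proof.
move=> /[dup] Cf [cf f0 _] [cg g0 _] gf; apply: C0nneg_dominated Cf.
  exact: continuous_subf.
by move=> x; rewrite subr_ge0 gf lerBlDr lerDl g0.
Qed.

Lemma C0nneg_trunc f (c : R) : 0 <= c -> C0nneg f ->
  C0nneg (fun x => Num.max (f x - c) 0).
Proof.
move=> c0 /[dup] Cf [cf f0 _]; apply: C0nneg_dominated Cf.
  apply: continuous_maxf; last exact: cst_continuous.
  by apply: continuous_subf => //; exact: cst_continuous.
by move=> x; rewrite le_max lexx orbT/= ge_max f0 lerBlDr lerDl c0.
Qed.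

Lemma C0nneg_sum (I : Type) (s : seq I) (F : I -> S -> R) :
  (forall i, C0nneg (F i)) -> C0nneg (fun x => \sum_(i <- s) F i x).
Proof.
move=> cF; elim: s => [|i s IH].
  by under eq_fun do rewrite big_nil; exact: C0nneg0.
by under eq_fun do rewrite big_cons; exact: C0nnegD.
Qed.

End C0nneg_theory.

Section urysohn_locally_compact.
Context (R : realType) (S : ptopologicalType).
Hypothesis S_hausdorff : hausdorff_space S.
Hypothesis S_lcompact : locally_compact [set: S].

(** The function must also vanish at infinity. The point is therefore separated from [B] together
    with the complement of the interior of a compact neighbourhood [V], which forces the positive
    superlevel sets into [V]. *)
Lemma locally_compact_bump (x : S) (B : set S) : closed B -> ~ B x ->
  exists f : S -> R, [/\ C0nneg f, forall y, f y <= 1, f x = 1 &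
    forall y, B y -> f y = 0].
Proof.
move=> cB Bx.
have [V xV [kV clV]] := S_lcompact (I : [set: S] x).
rewrite withinET in xV.
pose D := B `|` ~` V°.
have cD : closed D by apply: closedU => //; apply: open_closedC; exact: open_interior.
have Dx : ~ D x by case => //; apply; exact: xV.
have /(_ cD Dx) := @locally_compact_completely_regular S R S_lcompact S_hausdorff x D.
move=> /uniform_separatorP => /(_ R)[f [cf f01 fx fD]].
have {}f01 y : 0 <= f y <= 1.
  by have := f01 (f y) (ex_intro2 _ _ y I erefl); rewrite /= in_itv.
have cg : continuous (fun y => 1 - f y).
  by apply: continuous_subf => //; exact: cst_continuous.
exists (fun y => 1 - f y); split.
- split => // [y|e e0]; first by rewrite subr_ge0; case/andP: (f01 y).
  apply: (subclosed_compact (closed_gef cg) kV) => y /= ey.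
  apply: interior_subset; apply: contrapT => Vy.
  have fy : f y = 1 by apply: fD; exists y => //; right.
  by move: ey; rewrite fy subrr leNgt e0.
- by move=> y; rewrite lerBlDr lerDl; case/andP: (f01 y).
- by rewrite (_ : f x = 0) ?subr0//; apply: fx; exists x.
- by move=> y By; rewrite (_ : f y = 1) ?subrr//; apply: fD; exists y => //; left.
Qed.

(** Near each point of [K] some bump exceeds 1/2, and finitely many of these neighbourhoods cover
    [K]; twice the sum of the bumps, cut off at 1, is then 1 on [K] and still vanishes on [B]. *)
Lemma urysohn_compact_closed (K B : set S) : compact K -> closed B ->
  (forall x, K x -> ~ B x) ->
  exists f : S -> R, [/\ C0nneg f, forall y, f y <= 1,
    forall y, K y -> f y = 1 & forall y, B y -> f y = 0].
Proof.
move=> kK cB KB.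
have F x : {f : S -> R | K x -> [/\ C0nneg f, forall y, f y <= 1, f x = 1 &
    forall y, B y -> f y = 0]}.
  apply: cid; have [Kx|] := pselect (K x); last by exists (fun=> 0).
  by have [f Hf] := locally_compact_bump cB (KB x Kx); exists f.
pose f x := sval (F x).
have fP x : K x -> _ := svalP (F x).
have := kK; rewrite compact_cover.
move=> /(_ _ K (fun x => [set y | 2^-1 < f x y]))[|y Ky|D' D'K cov].
- by move=> x Kx; apply: open_gtf; case: (fP x Kx) => -[].
- exists y => //=; have [_ _ fy _] := fP y Ky.
  by rewrite /f fy invf_lt1 ?ltr1n.
(* Nothing is known of [f x] for [x] outside [K]; the value 0 off [D'] puts every [g x] in the
   cone. *)
pose g x := if x \in D' then f x else fun=> 0.
have gC x : C0nneg (g x).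
  rewrite /g; case: ifPn => [xD|_]; last exact: C0nneg0.
  by have /set_mem/fP[] := D'K _ xD.
pose h y := \sum_(x <- D') g x y.
have hC : C0nneg h by exact: C0nneg_sum.
have h2 : C0nneg (fun y => h y + h y) by exact: C0nnegD.
exists (fun y => Num.min (h y + h y) 1); split.
- exact: C0nneg_min_cst.
- by move=> y; rewrite ge_min lexx orbT.
- move=> y /cov[x /= xD] xy; apply/min_idPr.
  have : 2^-1 <= h y.
    rewrite /h (bigD1_seq x) ?fset_uniq//= {1}/g xD.
    apply: (le_trans (ltW xy)); rewrite lerDl sumr_ge0// => i _.
    exact: C0nneg_ge0 (gC i) y.
  lra.
- move=> y By; have -> : h y = 0.
    rewrite /h big1_seq// => x /andP[_ xD]; rewrite /g xD.
    by have /set_mem/fP[_ _ _] := D'K _ xD; apply.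
  by rewrite addr0; apply/min_idPl.
Qed.

End urysohn_locally_compact.

(** * Bounded measurable functions *)

(** Such functions are integrable against every finite measure and form an algebra, which settles
    the integrability conditions of linearity and monotonicity once and for all. *)
Definition bounded_measurable (R : realType) d (T : measurableType d)
    (f : T -> R) :=
  measurable_fun setT f /\ exists M, forall x, `|f x| <= M.

Section bounded_measurable_theory.
Context (R : realType) d (T : measurableType d).
Implicit Types (f g : T -> R) (mu : {finite_measure set T -> \bar R}).

Lemma bounded_measurable_cst (c : R) :
  @bounded_measurable R d T (fun=> c).
Proof. by split; [exact: measurable_cst|exists `|c|]. Qed.

Lemma bounded_measurableD f g :
  bounded_measurable f -> bounded_measurable g ->
  bounded_measurable (fun x => f x + g x).
Proof.
move=> [mf [M fM]] [mg [N gN]]; split; first exact: measurable_funD.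
by exists (M + N) => x; rewrite (le_trans (ler_normD _ _))// lerD.
Qed.

Lemma bounded_measurableM f g :
  bounded_measurable f -> bounded_measurable g ->
  bounded_measurable (fun x => f x * g x).
Proof.
move=> [mf [M fM]] [mg [N gN]]; split; first exact: measurable_funM.
by exists (M * N) => x; rewrite normrM ler_pM.
Qed.

Lemma bounded_measurableZ (c : R) f :
  bounded_measurable f -> bounded_measurable (fun x => c * f x).
Proof. exact/bounded_measurableM/bounded_measurable_cst. Qed.

Lemma bounded_measurableB f g :
  bounded_measurable f -> bounded_measurable g ->
  bounded_measurable (fun x => f x - g x).
Proof.
move=> bf bg; under eq_fun do rewrite -mulN1r.
exact/bounded_measurableD/bounded_measurableZ.
Qed.

Lemma bounded_measurable_indic (A : set T) : measurable A ->
  bounded_measurable (\1_A : T -> R).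
Proof.
move=> mA; split; first exact: measurable_indic.
by exists 1 => x; rewrite indicE; case: (_ \in _); rewrite ?normr1 ?normr0.
Qed.

Lemma bounded_measurable_integrable mu f : bounded_measurable f ->
  mu.-integrable setT (EFin \o f).
Proof.
move=> [mf [M fM]]; apply: measurable_bounded_integrable => //.
  by rewrite ltey_eq fin_num_measure.
by exists M; split; rewrite ?num_real// => N MN x _ /=; exact/le_trans/ltW/MN.
Qed.

Lemma bm_RintegralD mu f g : bounded_measurable f -> bounded_measurable g ->
  \int[mu]_x (f x + g x) = \int[mu]_x f x + \int[mu]_x g x.
Proof. by move=> bf bg; rewrite RintegralD//; exact: bounded_measurable_integrable. Qed.

Lemma bounded_measurable_sum (I : Type) (s : seq I) (F : I -> T -> R) :
  (forall i, bounded_measurable (F i)) ->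
  bounded_measurable (fun x => \sum_(i <- s) F i x).
Proof.
move=> bF; elim: s => [|i s IH].
  by under eq_fun do rewrite big_nil; exact: bounded_measurable_cst.
by under eq_fun do rewrite big_cons; exact: bounded_measurableD.
Qed.

Lemma bm_Rintegral_sum mu (I : Type) (s : seq I) (F : I -> T -> R) :
  (forall i, bounded_measurable (F i)) ->
  \int[mu]_x (\sum_(i <- s) F i x) = \sum_(i <- s) \int[mu]_x F i x.
Proof.
move=> bF; elim: s => [|i s IH].
  rewrite big_nil -[RHS](mul0r (fine (mu setT))) -Rintegral_cst//.
  by apply: eq_Rintegral => x _; rewrite big_nil.
rewrite big_cons -IH -bm_RintegralD//; last exact: bounded_measurable_sum.
by apply: eq_Rintegral => x _; rewrite big_cons.
Qed.

Lemma bm_RintegralZ mu c f : bounded_measurable f ->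
  \int[mu]_x (c * f x) = c * \int[mu]_x f x.
Proof. by move=> bf; rewrite RintegralZl//; exact: bounded_measurable_integrable. Qed.

Lemma bm_le_Rintegral mu f g : bounded_measurable f -> bounded_measurable g ->
  (forall x, f x <= g x) -> \int[mu]_x f x <= \int[mu]_x g x.
Proof.
by move=> bf bg fg; apply: le_Rintegral => //; exact: bounded_measurable_integrable.
Qed.

Lemma Rintegral_indic mu (A : set T) : measurable A ->
  \int[mu]_x \1_A x = fine (mu A).
Proof. by move=> mA; rewrite /Rintegral integral_indic// setIT. Qed.

Lemma bm_normr_Rintegral mu f M : bounded_measurable f ->
  (forall x, `|f x| <= M) -> `|\int[mu]_x f x| <= M * fine (mu setT).
Proof.
move=> /[dup] bf [mf _] fM; rewrite -Rintegral_cst//.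
apply: le_trans (le_normr_Rintegral _ (bounded_measurable_integrable _ bf)) _ => //.
apply: bm_le_Rintegral => //; last exact: bounded_measurable_cst.
by split; [exact: measurableT_comp|exists M => x; rewrite normr_id].
Qed.

End bounded_measurable_theory.

Section borel_sets.
Context (R : realType) (S : ptopologicalType).

Lemma open_borel (U : set S) : open U -> measurable (U : set (borel S)).
Proof. exact: sub_gen_smallest. Qed.

Lemma closed_borel (U : set S) : closed U -> measurable (U : set (borel S)).
Proof.
move=> cU; rewrite -(setCK U); apply: measurableC.
by apply: open_borel; exact: closed_openC.
Qed.

Lemma compact_borel (K : set S) : hausdorff_space S -> compact K ->
  measurable (K : set (borel S)).
Proof. by move=> hS kK; apply: closed_borel; exact: compact_closed. Qed.

Lemma continuous_borel (f : S -> R) : continuous f ->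
  measurable_fun setT (f : borel S -> R).
Proof.
move=> /continuousP cf; apply: (measurability _ (RGenOpens.measurableE R)).
move=> _ [_ [a [b ->] <-]]; rewrite setTI; apply: open_borel.
exact/cf/interval_open.
Qed.

Lemma C0nneg_bounded_measurable (f : S -> R) : C0nneg f ->
  bounded_measurable (f : borel S -> R).
Proof.
move=> [cf f0 vf]; split; first exact: continuous_borel.
have /(@compact_bounded R R^o)[M [_ /(_ (M + 1))]] :=
  continuous_compact (continuous_subspaceT cf) (vf 1 ltr01).
rewrite ltrDl ltr01 => /(_ isT) bM.
exists (Num.max 1 (M + 1)) => x /=; rewrite le_max.
have [f1|f1] := leP (f x) 1; first by rewrite ger0_norm// f1.
by apply/orP; right; apply: bM; exists x => //=; exact: ltW.
Qed.

End borel_sets.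

(** * Riesz representation of positive functionals *)

Section positive_functional.
Context (R : realType) (S : ptopologicalType).
Hypothesis S_hausdorff : hausdorff_space S.
Hypothesis S_lcompact : locally_compact [set: S].
Variables (Lam : (S -> R) -> R) (B : R).
Hypothesis LamD : forall f g, C0nneg f -> C0nneg g ->
  Lam (fun x => f x + g x) = Lam f + Lam g.
Hypothesis Lam_ge0 : forall f, C0nneg f -> 0 <= Lam f.
Hypothesis Lam_le : forall f M, C0nneg f -> (forall x, f x <= M) -> Lam f <= B * M.

Let C0nneg0S : @C0nneg R S (fun=> 0).
Proof. exact: C0nneg0. Qed.

Lemma Lam0 : Lam (fun=> 0) = 0.
Proof.
have := LamD C0nneg0S C0nneg0S; under eq_fun do rewrite addr0.
by move/eqP; rewrite -subr_eq0 opprD addrA subrr sub0r oppr_eq0 => /eqP.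
Qed.

Lemma Lam_bound_ge0 : 0 <= B.
Proof. by have := Lam_le C0nneg0S (fun=> ler01); rewrite Lam0 mulr1. Qed.

Lemma Lam_mono f g : C0nneg f -> C0nneg g -> (forall x, f x <= g x) ->
  Lam f <= Lam g.
Proof.
move=> Cf Cg fg; have Cgf := C0nneg_sub Cg Cf fg.
have -> : g = (fun x => f x + (g x - f x)) by apply/funext => x; rewrite addrC subrK.
by rewrite LamD// lerDl Lam_ge0.
Qed.

(** Additivity alone gives homogeneity for integer factors. This is enough for the layer-cake
    estimate, where layers of height [1 / (N + 1)] are rescaled to height 1. *)
Lemma Lam_muln f n : C0nneg f -> Lam (fun x => f x *+ n) = Lam f *+ n.
Proof.
move=> Cf; suff [] : C0nneg (fun x => f x *+ n) /\
  Lam (fun x => f x *+ n) = Lam f *+ n by [].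
elim: n => [|n [Cn IH]]; first by rewrite mulr0n -[RHS]Lam0.
rewrite mulrS -IH -LamD//; under eq_fun do rewrite mulrS.
by split => //; exact: C0nnegD.
Qed.

Lemma Lam_sum n (F : nat -> S -> R) : (forall i, C0nneg (F i)) ->
  Lam (fun x => \sum_(i < n) F i x) = \sum_(i < n) Lam (F i).
Proof.
move=> CF; elim: n => [|n IH].
  by rewrite big_ord0 -[RHS]Lam0; congr Lam; apply/funext => x; rewrite big_ord0.
rewrite big_ord_recr/= -IH -LamD//; last exact: C0nneg_sum.
by congr Lam; apply/funext => x; rewrite big_ord_recr.
Qed.

(** Vanishing off [U] replaces the usual condition of compact support in [U]. The set is arbitrary,
    so that the notion also applies to compact sets. *)
Definition subordinate (U : set S) (f : S -> R) :=
  [/\ C0nneg f, forall x, f x <= 1 & forall x, ~ U x -> f x = 0].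

Definition content (U : set S) : R := sup [set Lam f | f in subordinate U].

Lemma content_has_sup U : has_sup [set Lam f | f in subordinate U].
Proof.
split; first by exists (Lam (fun=> 0)), (fun=> 0) => //; split.
by exists (B * 1) => _ [f [Cf f1 _] <-]; exact: Lam_le.
Qed.

Lemma Lam_le_content U f : subordinate U f -> Lam f <= content U.
Proof.
by move=> Uf; apply: sup_ubound; [exact: (content_has_sup U).2|exists f].
Qed.

Lemma content_le U M : (forall f, subordinate U f -> Lam f <= M) -> content U <= M.
Proof.
move=> UM; apply: sup_le_ub; first exact: (content_has_sup U).1.
by move=> _ [f /UM ? <-].
Qed.

Lemma content_ge0 U : 0 <= content U.
Proof. by rewrite -Lam0; apply: Lam_le_content; split. Qed.

Lemma content_leB U : content U <= B.
Proof. by apply: content_le => f [Cf f1 _]; rewrite -(mulr1 B); exact: Lam_le. Qed.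

Lemma content_mono U V : U `<=` V -> content U <= content V.
Proof.
move=> UV; apply: content_le => f [Cf f1 fU]; apply: Lam_le_content.
by split => // x Vx; apply: fU => /UV.
Qed.

(** What truncation removes is [min f d], on which [Lam] is at most [B * d]. *)
Lemma Lam_trunc f d : 0 <= d -> C0nneg f ->
  Lam f <= Lam (fun x => Num.max (f x - d) 0) + B * d.
Proof.
move=> d0 Cf; rewrite [X in Lam X <= _](_ : f =
    (fun x => Num.max (f x - d) 0 + Num.min (f x) d)); last first.
  by apply/funext => x; case: (leP (f x) d) => fd; [rewrite max_r|rewrite max_l];
    lra.
rewrite LamD; [|exact: C0nneg_trunc|exact: C0nneg_min_cst].
rewrite lerD2l Lam_le//; first exact: C0nneg_min_cst.
by move=> x; rewrite ge_min lexx orbT.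
Qed.

(** Truncation replaces a function subordinate to [U] by functions with compact
    support in [U]. *)
Lemma content_le_compact U M :
  (forall K f, compact K -> K `<=` U -> subordinate K f -> Lam f <= M) ->
  content U <= M.
Proof.
move=> UM; apply: content_le => f [Cf f1 fU].
apply/ler_addgt0Pr => e e0.
(* [B] may be 0; dividing by [1 + B] still makes [B * d] at most [e]. Later error constants have the
   same shape. *)
have B1 : 0 < 1 + B by rewrite ltr_pwDl// Lam_bound_ge0.
pose d := e / (1 + B).
have d0 : 0 < d by rewrite divr_gt0.
apply: (le_trans (Lam_trunc (ltW d0) Cf)); apply: lerD.
  apply: (UM [set x | d <= f x]).
  - exact: C0nneg_compact Cf _ d0.
  - move=> x /= dx; apply: contrapT => /fU fx0.
    by move: dx; rewrite fx0 leNgt d0.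
  - split=> [|x|x /negP]; first exact: (C0nneg_trunc (ltW d0)).
      by rewrite ge_max ler01 andbT; have := f1 x; lra.
    by rewrite -ltNge => /ltW fd; apply/max_idPr; rewrite subr_le0.
by rewrite /d mulrCA ger_pMr// ler_pdivrMr// mul1r lerDr.
Qed.

(** For [f] carried by a compact subset [K] of the union, a Urysohn function [g] equal to 1 on
    [K \ V] and to 0 off [U] splits [f] into [g f], subordinate to [U], and [(1 - g) f], subordinate
    to [V]. *)
Lemma contentU U V : open U -> open V ->
  content (U `|` V) <= content U + content V.
Proof.
move=> oU oV; apply: content_le_compact => K f kK KUV [Cf f1 fK].
have kKV : compact (K `\` V).
  by rewrite setDE; apply: compact_closedI => //; exact: open_closedC.
have [x [Kx Vx]|g [Cg g1 gK gU]] := @urysohn_compact_closed R _ S_hausdorff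
    S_lcompact (K `\` V) (~` U) kKV (open_closedC oU).
  by case: (KUV x Kx) => // Ux; apply.
have cg := C0nneg_continuous Cg.
have g0 := C0nneg_ge0 Cg.
have f0 := C0nneg_ge0 Cf.
have Cgf : C0nneg (fun x => g x * f x).
  by apply: C0nneg_mull => // x; rewrite g0 g1.
have Cgf' : C0nneg (fun x => (1 - g x) * f x).
  apply: C0nneg_mull => // [|x].
    by apply: continuous_subf => //; exact: cst_continuous.
  by rewrite subr_ge0 g1 lerBlDr lerDl g0.
rewrite (_ : f = (fun x => g x * f x + (1 - g x) * f x)); last first.
  by apply/funext => x; rewrite -mulrDl addrC subrK mul1r.
rewrite LamD//; apply: lerD; apply: Lam_le_content; split => // x.
- by rewrite mulr_ile1.
- by move=> Ux; rewrite gU ?mul0r.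
- by rewrite mulr_ile1 ?subr_ge0// lerBlDr lerDl g0.
- move=> Vx; have [Kx|Kx] := pselect (K x); last by rewrite fK ?mulr0.
  by rewrite gK ?subrr ?mul0r.
Qed.

Lemma content_bigsetU (U : nat -> set S) n : (forall i, open (U i)) ->
  content (\big[setU/set0]_(i < n) U i) <= \sum_(i < n) content (U i).
Proof.
move=> oU; elim: n => [|n IH].
  rewrite !big_ord0; apply: content_le => f [Cf _ f0].
  by rewrite -Lam0 le_eqVlt; apply/orP; left; apply/eqP; congr Lam;
    apply/funext => x; apply: f0.
rewrite !big_ord_recr/=; apply: (le_trans (contentU _ (oU n))).
  by rewrite -bigcup_mkord; exact: bigcup_open.
by rewrite lerD2r.
Qed.

(** A function carried by a compact set sees only finitely many of the [U i], so finite
    subadditivity suffices. *)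
Lemma content_bigcup (U : nat -> set S) M : (forall i, open (U i)) ->
  (forall n, \sum_(i < n) content (U i) <= M) -> content (\bigcup_i U i) <= M.
Proof.
move=> oU UM; apply: content_le_compact => K f kK KU Kf.
have [N KN] : exists N, K `<=` \big[setU/set0]_(i < N) U i.
  move: kK; rewrite compact_cover => /(_ nat setT U (fun i _ => oU i) KU)[D _ KD].
  exists (\max_(i <- D) i).+1 => x /KD[i /= iD Ux].
  rewrite -bigcup_mkord; exists i => //=; rewrite ltnS.
  by rewrite (big_fsetD1 i)//= leq_maxl.
apply: le_trans (UM N); apply: le_trans (content_bigsetU _ oU).
apply: Lam_le_content; case: Kf => Cf f1 fK; split => // x Nx.
by apply: fK => /KN.
Qed.

(** * Outer measure and measurability of Borel sets *)

Definition outer (E : set S) : \bar R :=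
  ereal_inf [set (content U)%:E | U in [set U | open U /\ E `<=` U]].

Lemma outer_ge0 E : (0 <= outer E)%E.
Proof.
by apply: le_ereal_inf_tmp => _ [U _ <-]; rewrite lee_fin content_ge0.
Qed.

Lemma outer_le E U : open U -> E `<=` U -> (outer E <= (content U)%:E)%E.
Proof. by move=> oU EU; apply: ereal_inf_lbound; exists U. Qed.

Lemma outer_open U : open U -> outer U = (content U)%:E.
Proof.
move=> oU; apply/eqP; rewrite eq_le outer_le//=.
apply: le_ereal_inf_tmp => _ [V [_ UV] <-]; rewrite lee_fin.
exact: content_mono.
Qed.

Lemma outer_fin_num E : outer E \is a fin_num.
Proof.
rewrite ge0_fin_numE ?outer_ge0//.
exact: le_lt_trans (outer_le openT (@subsetT _ _)) (ltry _).
Qed.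

Lemma outer_adherent E (e : R) : 0 < e -> exists U, [/\ open U, E `<=` U &
  ((content U)%:E <= outer E + e%:E)%E].
Proof.
move=> e0; have [_ [U [oU EU] <-] /ltW] := lb_ereal_inf_adherent e0 (outer_fin_num E).
by exists U.
Qed.

Let outer0 : outer set0 = 0%E.
Proof.
rewrite outer_open; last exact: open0.
congr (_%:E); apply/eqP; rewrite eq_le content_ge0 andbT.
apply: content_le => f [Cf _ f0]; rewrite (_ : f = fun=> 0) ?Lam0//.
by apply/funext => x; apply: f0.
Qed.

Let outer_mono : {homo outer : E F / E `<=` F >-> (E <= F)%E}.
Proof.
move=> E F EF; apply: le_ereal_inf_tmp => _ [U [oU FU] <-].
by apply: outer_le => //; exact: subset_trans FU.
Qed.

Let outer_sigma_subadditive : sigma_subadditive outer.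
Proof.
move=> F; apply/lee_addgt0Pr => e e0.
apply: le_trans (epsilon_trick _ _ (ltW e0)); last by move=> n; exact: outer_ge0.
have /choice[U UP] : forall n, exists U, [/\ open U, F n `<=` U &
    ((content U)%:E <= outer (F n) + (e / (2 ^ n.+1)%:R)%:E)%E].
  by move=> n; apply: outer_adherent; rewrite divr_gt0// ltr0n expn_gt0.
set s := (X in (_ <= X)%E).
have sum_ge0 n : (0 <= outer (F n) + (e / (2 ^ n.+1)%:R)%:E)%E.
  by rewrite adde_ge0 ?outer_ge0// lee_fin divr_ge0// ltW.
have sn n : ((\sum_(i < n) content (U i))%:E <= s)%E.
  apply: (@le_trans _ _
      (\sum_(0 <= i < n) (outer (F i) + (e / (2 ^ i.+1)%:R)%:E))%E); last first.
    by apply: nneseries_lim_ge => i *; exact: sum_ge0.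
  rewrite -sumEFin big_mkord; apply: lee_sum => i _.
  by have [] := UP i.
have oUU : open (\bigcup_i U i) by apply: bigcup_open => i _; have [] := UP i.
apply: (@le_trans _ _ (content (\bigcup_i U i))%:E).
  apply: outer_le => //; apply: subset_bigcup => i _.
  by have [] := UP i.
case: s sn => [s sn| _ |/(_ 0%N)]; [|by rewrite leey|by []].
rewrite lee_fin; apply: content_bigcup => [i|n]; first by have [] := UP i.
by have := sn n; rewrite lee_fin.
Qed.

HB.instance Definition _ := isOuterMeasure.Build R S outer
  outer0 outer_ge0 outer_mono outer_sigma_subadditive.

(** Let [V] be an open set containing [E], [f] subordinate to a compact [K] inside [V] and [U], and
    [g] subordinate to [V \ K], which is open and contains [V \ U]. At each point [f] or [g]
    vanishes, so [f + g] is subordinate to [V]; suprema over [g] and then over [f] bound [content V]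
    from below. *)
Lemma outer_caratheodory_open U : open U -> outer.-caratheodory U.
Proof.
move=> oU; apply: le_caratheodory_measurable => E.
apply: le_ereal_inf_tmp => _ [V [oV EV] <-].
apply: (@le_trans _ _ ((content (V `&` U))%:E + outer (V `&` ~` U))%E).
  apply: leeD; last by apply: outer_mono; exact: setSI.
  by apply: outer_le; [exact: openI|exact: setSI].
rewrite -leeBrDr ?outer_fin_num// -(fineK (outer_fin_num (V `&` ~` U))) -EFinB lee_fin.
apply: content_le_compact => K f kK KVU [Cf f1 fK].
rewrite lerBrDr -lerBrDl.
rewrite -lee_fin fineK ?outer_fin_num//.
have oVK : open (V `\` K).
  rewrite setDE; apply: openI => //; apply: closed_openC.
  exact: compact_closed.
apply: (@le_trans _ _ (content (V `\` K))%:E).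
  by apply: outer_le => // x [Vx Ux]; split => // /KVU[].
rewrite lee_fin; apply: content_le => g [Cg g1 gVK].
rewrite lerBrDl -LamD//; apply: Lam_le_content; split; first exact: C0nnegD.
- move=> x; have [Kx|Kx] := pselect (K x).
    by rewrite (gVK x) ?addr0//; case.
  by rewrite fK ?add0r.
- move=> x Vx; rewrite fK ?add0r; last by move=> /KVU[].
  by apply: gVK => -[].
Qed.

Let sub_caratheodory (A : set (borel S)) :
  measurable A -> outer.-cara.-measurable A.
Proof.
move: A; apply: smallest_sub; first exact: sigma_algebra_measurable.
exact: outer_caratheodory_open.
Qed.

(** This is [outer] on the type [borel S], so that the measure structure refers to the Borel sets
    and not to the Caratheodory measurable ones. *)
Definition radon_measure (A : set (borel S)) : \bar R := outer A.

Let radon_measure0 : radon_measure set0 = 0%E.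
Proof. exact: outer0. Qed.

Let radon_measure_ge0 A : (0 <= radon_measure A)%E.
Proof. exact: outer_ge0. Qed.

Let radon_measure_sigma_additive : semi_sigma_additive radon_measure.
Proof.
move=> F mF tF mUF; apply: (caratheodory_measure_sigma_additive (mu := outer)) => //.
  by move=> i; exact: sub_caratheodory.
exact: sub_caratheodory.
Qed.

HB.instance Definition _ := isMeasure.Build _ _ _ radon_measure
  radon_measure0 radon_measure_ge0 radon_measure_sigma_additive.

Let radon_measure_fin : fin_num_fun radon_measure.
Proof. by move=> A _; exact: outer_fin_num. Qed.

HB.instance Definition _ := Measure_isFinite.Build _ _ _ radon_measure
  radon_measure_fin.

Lemma radon_compact_ge K f : subordinate K f -> ((Lam f)%:E <= radon_measure K)%E.
Proof.
move=> [Cf f1 fK]; apply: le_ereal_inf_tmp => _ [U [oU KU] <-]; rewrite lee_fin.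
by apply: Lam_le_content; split => // x Ux; apply: fK => /KU.
Qed.

Lemma radon_open_inner U (e : R) : open U -> 0 < e ->
  exists K, [/\ compact K, K `<=` U & ((content U - e)%:E < radon_measure K)%E].
Proof.
move=> oU e0; apply: contrapT => noK.
suff : content U <= content U - e by rewrite lerBrDr gerDl leNgt e0.
apply: content_le_compact => K f kK KU Kf; rewrite leNgt; apply/negP => Kf'.
apply: noK; exists K; split => //; apply: lt_le_trans (radon_compact_ge Kf).
by rewrite lte_fin.
Qed.

(** Finiteness turns outer regularity of the complement into inner regularity: if the open [U]
    exceeds [~ A] by little and the compact [K] misses little mass, then [K \ U] is a compact subset
    of [A], and what it loses of [A] lies in [~ K] or in [U \ ~ A]. *)
Lemma radon_inner (A : set (borel S)) (e : R) : measurable A -> 0 < e ->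
  exists K, [/\ compact K, K `<=` A & (radon_measure (A `\` K) < e%:E)%E].
Proof.
move=> mA e0; have e4 : 0 < e / 4 by rewrite divr_gt0.
have [U [oU AU UA]] := outer_adherent (~` A) e4.
have [K [kK _ KS]] := radon_open_inner openT e4.
have mU : measurable (U : set (borel S)) by exact: open_borel.
have mK : measurable (K : set (borel S)) by exact: compact_borel.
exists (K `&` ~` U); split.
- by apply: compact_closedI => //; exact: open_closedC.
- by move=> x [Kx Ux]; apply: contrapT => /AU.
have AKU : A `\` (K `&` ~` U) `<=` ~` K `|` (U `\` ~` A).
  move=> x [Ax KUx]; have [Kx|Kx] := pselect (K x); last by left.
  by right; split; [apply: contrapT => Ux; apply: KUx|exact].
have rK : (radon_measure (~` K) <= (e / 4)%:E)%E.
  rewrite -setTD measureD//=; last by rewrite ltey_eq fin_num_measure.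
  rewrite setTI leeBlDr ?fin_num_measure// [radon_measure setT]outer_open;
    last exact: openT.
  by move: KS; rewrite EFinB => /ltW; rewrite leeBlDr ?fin_num_measure// addeC.
have rU : (radon_measure (U `\` ~` A) <= (e / 4)%:E)%E.
  rewrite measureD//=; last 2 first.
  - exact: measurableC.
  - by rewrite ltey_eq fin_num_measure.
  have -> : U `&` ~` A = ~` A by apply/setIidr.
  rewrite leeBlDr ?fin_num_measure//; last exact: measurableC.
  by rewrite [radon_measure U]outer_open// addeC.
apply: (@le_lt_trans _ _ ((e / 4)%:E + (e / 4)%:E)%E); last first.
  by rewrite -EFinD lte_fin; lra.
apply: le_trans (leeD rK rU); apply: le_trans (outer_mono AKU) _.
exact: outer_measureU2.
Qed.

(** * Layer-cake formula *)

Section layer_cake.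
Variables (f : S -> R) (N : nat).
Hypothesis Cf : C0nneg f.

Let h : R := N.+1%:R^-1.

Let h_gt0 : 0 < h.
Proof. by rewrite invr_gt0 ltr0n. Qed.

(** The slice of [f] between the heights [k h] and [(k + 1) h], with values in [[0, h]]. *)
Let layer k x := Num.min (f x) (k.+1%:R * h) - Num.min (f x) (k%:R * h).

Let layer_C0nneg k : C0nneg (layer k).
Proof.
have kh0 j : 0 <= j%:R * h by rewrite mulr_ge0// ltW.
apply: C0nneg_sub => [||x]; [exact: C0nneg_min_cst..|].
by rewrite le_min !ge_min lexx/= ler_pM2r// ler_nat leqnSn orbT.
Qed.

Let U k := [set x | k%:R * h < f x].

Let U_open k : open (U k).
Proof. exact: (open_gtf _ (C0nneg_continuous Cf)). Qed.

Let layer_ge k x : h * \1_(U k.+1) x <= layer k x.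
Proof.
rewrite indicE; have [|] := boolP (x \in U k.+1) => xU.
  have kx : k.+1%:R * h < f x by have := set_mem xU.
  have kk : k%:R * h <= k.+1%:R * h by rewrite ler_pM2r// ler_nat.
  rewrite /layer min_r ?(ltW kx)// min_r; last by apply: le_trans (ltW kx).
  by rewrite -mulrBl -natrB// subSnn mul1r mulr1.
by rewrite mulr0 (C0nneg_ge0 (layer_C0nneg k)).
Qed.

Let layer_le k x : layer k x <= h * \1_(U k) x.
Proof.
rewrite indicE /layer -natr1 mulrDl mul1r.
have [/set_mem/= kx|kx] := boolP (x \in U k).
  rewrite mulr1 (min_r (ltW kx)).
  by rewrite lerBlDl ge_min lexx orbT.
have {}kx : f x <= k%:R * h by rewrite leNgt; apply/negP => /mem_set; apply/negP.
rewrite mulr0 (min_l kx) min_l ?subrr//.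
by apply: le_trans kx _; rewrite lerDl ltW.
Qed.

(** With [c k] the content of [{f > k h}], both [Lam] and the integral of layer [k] lie between
    [h c (k+1)] and [h c k]. The gaps telescope to at most [h c 0 <= h B]. *)
Lemma layer_cake_estimate :
  `|Lam f - \int[radon_measure]_x f x| <= h * B.
Proof.
have [_ [M fM]] := C0nneg_bounded_measurable Cf.
have [n Mn] : exists n, M <= n%:R * h.
  exists (Num.bound `|M / h|); rewrite -ler_pdivrMr//.
  apply: le_trans (ler_norm _) _; by apply/ltW/archi_boundP.
have fE : f = fun x => \sum_(i < n) layer i x.
  apply/funext => x; rewrite -(big_mkord xpredT (fun i => layer i x)) telescope_sumr//.
  rewrite mul0r (min_r (C0nneg_ge0 Cf x)) subr0 min_l//.
  by apply: le_trans (ler_norm _) _; apply: le_trans (fM x) _.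
pose c k := content (U k).
(* Multiplied by [N + 1], layer [k] takes values in [[0, 1]]: it is subordinate to [U k] and
   dominates every function subordinate to [U k.+1], so the definition of [content] gives both
   bounds. *)
have LamI k : h * c k.+1 <= Lam (layer k) <= h * c k.
  have h0 : N.+1%:R != 0 :> R by rewrite pnatr_eq0.
  have CN : C0nneg (fun x => layer k x *+ N.+1).
    rewrite (_ : (fun _ => _) = fun x => \sum_(i < N.+1) layer k x); last first.
      by apply/funext => x; rewrite sumr_const card_ord.
    exact: C0nneg_sum.
  have -> : Lam (layer k) = h * Lam (fun x => layer k x *+ N.+1).
    by rewrite Lam_muln// -mulr_natr mulrCA mulVf ?mulr1.
  rewrite !ler_pM2l//.
  apply/andP; split.
    apply: content_le => g [Cg g1 gU]; apply: Lam_mono => // x.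
    rewrite -mulr_natr -ler_pdivrMr ?ltr0n// mulrC -/h.
    apply: le_trans (layer_ge k x); rewrite ler_pM2l// indicE.
    by have [//|xU] := boolP (x \in U k.+1); rewrite gU// => /mem_set; apply/negP.
  apply: Lam_le_content; split => // x.
    rewrite -mulr_natr -ler_pdivlMr ?ltr0n// mul1r (le_trans (layer_le k x))//.
    by rewrite -/h indicE; case: (_ \in _); rewrite ?mulr1 ?mulr0 ?(ltW h_gt0).
  move=> Ux; suff -> : layer k x = 0 by rewrite mul0rn.
  apply/eqP; rewrite eq_le (C0nneg_ge0 (layer_C0nneg k)) andbT.
  by apply: le_trans (layer_le k x) _; rewrite indicE memNset// mulr0.
have layer_bm k := C0nneg_bounded_measurable (layer_C0nneg k).
have mU k : measurable (U k : set (borel S)) by exact: open_borel.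
have intI k : h * c k.+1 <= \int[radon_measure]_x layer k x <= h * c k.
  have cE j : c j = fine (radon_measure (U j)) by rewrite /radon_measure outer_open.
  rewrite !cE -!Rintegral_indic// -!bm_RintegralZ; [|exact: bounded_measurable_indic..].
  by apply/andP; split; apply: bm_le_Rintegral => //;
    exact/bounded_measurableZ/bounded_measurable_indic.
have intE : \int[radon_measure]_x f x =
    \sum_(i < n) \int[radon_measure]_x layer i x.
  by rewrite -bm_Rintegral_sum//; apply: eq_Rintegral => x _; rewrite {1}fE.
have -> : Lam f = \sum_(i < n) Lam (layer i) by rewrite {1}fE Lam_sum.
rewrite intE -sumrB; apply: le_trans (ler_norm_sum _ _ _) _.
apply: (@le_trans _ _ (\sum_(i < n) (h * c i - h * c i.+1))).
  by apply: ler_sum => i _; apply: ler_dist_itv; [exact: LamI|exact: intI].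
rewrite -(big_mkord xpredT (fun i => h * c i - h * c i.+1)).
rewrite (telescope_sumr_eq (fun i => - (h * c i)))//; last first.
  by move=> i _; rewrite opprK addrC.
rewrite opprK addrC -mulrBr ler_pM2l//.
by apply: le_trans (content_leB (U 0)); rewrite gerBl content_ge0.
Qed.

End layer_cake.

Lemma radon_measure_integral f : C0nneg f -> \int[radon_measure]_x f x = Lam f.
Proof.
move=> Cf; apply/esym/eqP; rewrite -subr_eq0 -normr_le0; apply/ler_addgt0Pr => e e0.
rewrite add0r; have [N BN] : exists N, B / e <= N%:R.
  exists (Num.bound `|B / e|); apply: le_trans (ler_norm _) _.
  by by apply/ltW/archi_boundP.
apply: le_trans (layer_cake_estimate N Cf) _.
rewrite mulrC ler_pdivrMr ?ltr0n// mulrC -ler_pdivrMr//.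
by apply: le_trans BN _; rewrite ler_nat.
Qed.

Theorem positive_riesz : exists m : {finite_measure set (borel S) -> \bar R},
  (forall (A : set (borel S)) (e : R), measurable A -> 0 < e ->
    exists K, [/\ compact K, K `<=` A & (m (A `\` K) < e%:E)%E]) /\
  (forall f, C0nneg f -> \int[m]_x f x = Lam f).
Proof.
exists radon_measure; split; [exact: radon_inner|exact: radon_measure_integral].
Qed.

End positive_functional.

(** * Step functions *)

Section complex_modulus.
Context (R : realType).
Local Open Scope complex_scope.
Implicit Types z w : R[i].

Lemma complexReD z w : complex.Re (z + w) = complex.Re z + complex.Re w.
Proof. by case: z w => [a b] [c d]. Qed.

Lemma complexImD z w : complex.Im (z + w) = complex.Im z + complex.Im w.
Proof. by case: z w => [a b] [c d]. Qed.

Lemma complexReN z : complex.Re (- z) = - complex.Re z.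
Proof. by case: z. Qed.

Lemma complexImN z : complex.Im (- z) = - complex.Im z.
Proof. by case: z. Qed.

Lemma complexReM z w :
  complex.Re (z * w) = complex.Re z * complex.Re w - complex.Im z * complex.Im w.
Proof. by case: z w => [a b] [c d]. Qed.

Lemma complexImM z w :
  complex.Im (z * w) = complex.Re z * complex.Im w + complex.Im z * complex.Re w.
Proof. by case: z w => [a b] [c d]. Qed.

Lemma complex_ext z w :
  complex.Re z = complex.Re w -> complex.Im z = complex.Im w -> z = w.
Proof. by case: z w => [a b] [c d] /= -> ->. Qed.

Lemma normc_real (a : R) : normc a%:C = `|a|.
Proof. by rewrite /normc/= expr0n addr0 sqrtr_sqr. Qed.

Lemma normc_le_ReIm z : normc z <= `|complex.Re z| + `|complex.Im z|.
Proof.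
case: z => a b /=.
rewrite -[leRHS]ger0_norm ?addr_ge0// -sqrtr_sqr ler_wsqrtr//.
by rewrite sqrrD !real_normK ?num_real// lerD2r lerDl mulrn_wge0// mulr_ge0.
Qed.

Lemma normc_sum (I : Type) (s : seq I) (P : pred I) (F : I -> R[i]) :
  normc (\sum_(i <- s | P i) F i) <= \sum_(i <- s | P i) normc (F i).
Proof.
elim/big_rec2 : _ => [|i y z _ IH]; first by rewrite normc0.
by apply: le_trans (le_normcD _ _) _; rewrite lerD2l.
Qed.

Lemma normcB_sym z w : normc (z - w) = normc (w - z).
Proof. by rewrite -normcN opprB. Qed.

Lemma normc_eq0_le z : (forall e : R, 0 < e -> normc z <= e) -> z = 0.
Proof.
move=> ze; apply: eq0_normc; apply/eqP; rewrite eq_le normc_ge0 andbT.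
by apply/ler_addgt0Pr => e e0; rewrite add0r ze.
Qed.

End complex_modulus.

(** * Integration against a real charge *)

Section charge_integral_theory.
Context (R : realType) d (T : measurableType d) (nu : {charge set T -> \bar R}).
Implicit Types f g : T -> R.

Let jp := jordan_pos (svalP (hahn nu)).
Let jn := jordan_neg (svalP (hahn nu)).

Lemma charge_integralD f g : bounded_measurable f -> bounded_measurable g ->
  charge_integral nu (fun x => f x + g x) =
  charge_integral nu f + charge_integral nu g.
Proof.
by move=> bf bg; rewrite /charge_integral !bm_RintegralD// opprD addrACA.
Qed.

Lemma charge_integralZ c f : bounded_measurable f ->
  charge_integral nu (fun x => c * f x) = c * charge_integral nu f.
Proof. by move=> bf; rewrite /charge_integral !bm_RintegralZ// mulrBr. Qed.

Lemma charge_integral_indic A : measurable A ->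
  charge_integral nu \1_A = fine (nu A).
Proof.
move=> mA; rewrite /charge_integral !Rintegral_indic//.
rewrite [in RHS](jordan_decomp (svalP (hahn nu)) mA) /cadd/= cscaleN1.
by rewrite fineB// fin_num_measure.
Qed.

Definition charge_mass := fine (jp setT) + fine (jn setT).

Lemma charge_mass_ge0 : 0 <= charge_mass.
Proof. by rewrite addr_ge0// fine_ge0. Qed.

Lemma charge_integral_le f M : bounded_measurable f ->
  (forall x, `|f x| <= M) -> `|charge_integral nu f| <= M * charge_mass.
Proof.
move=> bf fM; rewrite mulrDr; apply: le_trans (ler_normB _ _) _.
by apply: lerD; exact: bm_normr_Rintegral.
Qed.

End charge_integral_theory.

(** * Bounded Borel functions and Borel partitions *)

Definition bounded_borel (R : realType) (S : ptopologicalType) (f : S -> R[i]) :=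
  bounded_measurable ((fun x => complex.Re (f x)) : borel S -> R) /\
  bounded_measurable ((fun x => complex.Im (f x)) : borel S -> R).

(** A partition is a labelling [q] and its cells are the fibres, some possibly empty. A step
    function then has the form [c (q x)], and a common refinement is a pair of labellings. *)
Definition borel_partition (S : ptopologicalType) (I : Type) (q : S -> I) :=
  forall i, measurable (q @^-1` [set i] : set (borel S)).

Section bounded_borel_theory.
Context (R : realType) (S : ptopologicalType).
Local Open Scope complex_scope.
Implicit Types (f g : S -> R[i]).

Lemma bounded_borelD f g : bounded_borel f -> bounded_borel g ->
  bounded_borel (fun x => f x + g x).
Proof.
move=> [rf mf] [rg mg]; split.
  by under eq_fun do rewrite complexReD; exact: bounded_measurableD.
by under eq_fun do rewrite complexImD; exact: bounded_measurableD.
Qed.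

Lemma bounded_borelM f g : bounded_borel f -> bounded_borel g ->
  bounded_borel (fun x => f x * g x).
Proof.
move=> [rf mf] [rg mg]; split.
  under eq_fun do rewrite complexReM.
  by apply: bounded_measurableB; exact: bounded_measurableM.
under eq_fun do rewrite complexImM.
by apply: bounded_measurableD; exact: bounded_measurableM.
Qed.

Lemma bounded_borel_cst (c : R[i]) : @bounded_borel R S (fun=> c).
Proof. by split; exact: bounded_measurable_cst. Qed.

Lemma bounded_borelZ (c : R[i]) f : bounded_borel f ->
  bounded_borel (fun x => c * f x).
Proof. exact/bounded_borelM/bounded_borel_cst. Qed.

Lemma bounded_borelB f g : bounded_borel f -> bounded_borel g ->
  bounded_borel (fun x => f x - g x).
Proof.
move=> bf bg; under eq_fun do rewrite -mulN1r.
exact/bounded_borelD/bounded_borelZ.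
Qed.

Lemma bounded_borel_sum (I : Type) (s : seq I) (F : I -> S -> R[i]) :
  (forall i, bounded_borel (F i)) -> bounded_borel (fun x => \sum_(i <- s) F i x).
Proof.
move=> bF; elim: s => [|i s IH].
  by under eq_fun do rewrite big_nil; exact: bounded_borel_cst.
by under eq_fun do rewrite big_cons; exact: bounded_borelD.
Qed.

Lemma bounded_borel_real (f : S -> R) :
  bounded_measurable (f : borel S -> R) -> bounded_borel (fun x => (f x)%:C).
Proof. by move=> bf; split => //; exact: bounded_measurable_cst. Qed.

Lemma bounded_borel_indic (A : set (borel S)) : measurable A ->
  @bounded_borel R S (fun x => (\1_A x)%:C).
Proof. by move=> mA; apply: bounded_borel_real; exact: bounded_measurable_indic. Qed.

Lemma bounded_borelP f :
  measurable_fun setT ((fun x => complex.Re (f x)) : borel S -> R) ->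
  measurable_fun setT ((fun x => complex.Im (f x)) : borel S -> R) ->
  (exists M, forall x, normc (f x) <= M) -> bounded_borel f.
Proof.
move=> mr mi [M fM]; split; split => //; exists M => x.
  exact: le_trans (ler_Re_normc _) (fM x).
exact: le_trans (ler_Im_normc _) (fM x).
Qed.

Lemma borel_partition_pair (I J : Type) (q : S -> I) (r : S -> J) :
  borel_partition q -> borel_partition r -> borel_partition (fun x => (q x, r x)).
Proof.
move=> mq mr [i j]; rewrite (_ : _ @^-1` _ = q @^-1` [set i] `&` r @^-1` [set j]).
  exact: measurableI.
by apply/seteqP; split => x /= [] -> ->.
Qed.

Lemma borel_partition_mem (A : set (borel S)) : measurable A ->
  borel_partition (fun x : S => x \in A).
Proof.
move=> mA [].
  rewrite (_ : _ @^-1` _ = A)//; apply/seteqP; split => x /=; first exact: set_mem.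
  exact: mem_set.
rewrite (_ : _ @^-1` _ = ~` A); first exact: measurableC.
by apply/seteqP; split => x /=; [move/negbT/negP => xA /mem_set|exact: memNset].
Qed.

Lemma step_funE (I : finType) (q : S -> I) (c : I -> R[i]) :
  (fun x => c (q x)) =
  (fun x => \sum_i c i * (\1_(q @^-1` [set i]) x)%:C).
Proof.
apply/funext => x; rewrite (bigD1 (q x))//= indicE mem_set// mulr1.
rewrite big1 ?addr0// => i iq; rewrite indicE memNset ?mulr0//=.
by move=> qi; move: iq; rewrite qi eqxx.
Qed.

Lemma bounded_borel_step (I : finType) (q : S -> I) (c : I -> R[i]) :
  borel_partition q -> bounded_borel (fun x => c (q x)).
Proof.
move=> mq; rewrite step_funE; apply: bounded_borel_sum => i.
exact/bounded_borelZ/bounded_borel_indic.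
Qed.

(** The cells are the preimages of half-open intervals of length [e]. Shifting by the bound [M]
    makes [h] nonnegative, so that its truncation to a natural number is its floor. *)
Let real_partition (f : S -> R) (e : R) : 0 < e ->
  bounded_measurable (f : borel S -> R) -> exists n (q : S -> 'I_n.+1),
  borel_partition q /\ forall x y, q x = q y -> `|f x - f y| <= e.
Proof.
move=> e0 [mf [M fM]].
pose h x := (f x + M) / e.
have h0 x : 0 <= h x.
  rewrite divr_ge0 ?(ltW e0)// -lerBlDr sub0r.
  by have := fM x; rewrite ler_norml => /andP[].
pose n := Num.truncn ((M + M) / e).
have hn x : (Num.truncn (h x) < n.+1)%N.
  rewrite ltnS truncn_le_nat; apply: le_lt_trans (truncnS_gt ((M + M) / e)).
  by rewrite ler_pM2r ?invr_gt0// lerD2r (le_trans (ler_norm _)).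
exists n, (fun x => Ordinal (hn x)); split.
  move=> i; have -> : (fun x => Ordinal (hn x)) @^-1` [set i] =
      f @^-1` `[i%:R * e - M, i.+1%:R * e - M[%classic.
    apply/seteqP; split => x /=; rewrite in_itv/= lerBlDr ltrBrDr.
      move=> <-/=; rewrite -ler_pdivlMr// -ltr_pdivrMr//.
      exact: truncn_itv.
    rewrite -ler_pdivlMr// -ltr_pdivrMr// => /truncn_def hi.
    exact/val_inj.
  by rewrite -[X in measurable X]setTI; apply: mf => //; exact: measurable_itv.
move=> x y [hxy]; have := truncn_itv (h0 x); have := truncn_itv (h0 y).
rewrite hxy => hy hx; have := ler_dist_itv (a := (Num.truncn (h y))%:R)
  (b := (Num.truncn (h y)).+1%:R) (x := h x) (y := h y).
case/andP: hx => -> /ltW ->; case/andP: hy => -> /ltW -> /(_ isT isT).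
rewrite -natrB// subSnn -mulrBl opprD addrACA subrr addr0.
by rewrite normrM (gtr0_norm (_ : 0 < e^-1)) ?invr_gt0// ler_pdivrMr// mul1r.
Qed.

Lemma oscillation_partition f (e : R) : 0 < e -> bounded_borel f ->
  exists (I : finType) (q : S -> I),
  borel_partition q /\ forall x y, q x = q y -> normc (f x - f y) <= e.
Proof.
move=> e0 [bR bI]; have e20 : 0 < e / 2 by rewrite divr_gt0.
have [n [q [mq oq]]] := real_partition e20 bR.
have [m [r [mr orr]]] := real_partition e20 bI.
exists ('I_n.+1 * 'I_m.+1)%type, (fun x => (q x, r x)); split.
  exact: borel_partition_pair.
move=> x y [qxy rxy]; apply: le_trans (normc_le_ReIm _) _.
by rewrite complexReD complexImD complexReN complexImN (splitr e) lerD// ?oq ?orr.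
Qed.

Lemma step_approximation f (e : R) : 0 < e -> bounded_borel f ->
  exists (I : finType) (q : S -> I) (c : I -> R[i]),
  borel_partition q /\ forall x, normc (f x - c (q x)) <= e.
Proof.
move=> e0 bf; have [I [q [mq oq]]] := oscillation_partition e0 bf.
have /choice[c cP] : forall i, exists z, forall x, q x = i -> normc (f x - z) <= e.
  move=> i; have [[y qy]|noy] := pselect (exists y, q y = i).
    by exists (f y) => x qx; apply: oq; rewrite qx.
  by exists 0 => x qx; exfalso; apply: noy; exists x.
by exists I, q, c; split => // x; apply: cP.
Qed.

End bounded_borel_theory.

(** * Integration against a complex Radon measure *)

Section Mb_integral_theory.
Context (R : realType) (S : ptopologicalType).
Local Open Scope complex_scope.
Implicit Types (mu nu : Mb R S) (f g : S -> R[i]) (A : set (borel S)).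

Lemma Mb_integralD mu f g : bounded_borel f -> bounded_borel g ->
  Mb_integral mu (fun x => f x + g x) = Mb_integral mu f + Mb_integral mu g.
Proof.
move=> [rf mf] [rg mg]; rewrite /Mb_integral.
under [X in charge_integral (Re_charge mu) X - _]eq_fun do rewrite complexReD.
under [X in _ - charge_integral (Im_charge mu) X]eq_fun do rewrite complexImD.
under [X in charge_integral (Re_charge mu) X + _]eq_fun do rewrite complexImD.
under [X in _ + charge_integral (Im_charge mu) X]eq_fun do rewrite complexReD.
by apply: complex_ext; rewrite ?complexReD ?complexImD/= !charge_integralD//
  ?opprD addrACA.
Qed.

Lemma Mb_integralZ mu (c : R[i]) f : bounded_borel f ->
  Mb_integral mu (fun x => c * f x) = c * Mb_integral mu f.
Proof.
move=> [rf mf]; rewrite /Mb_integral.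
under [X in charge_integral (Re_charge mu) X - _]eq_fun do rewrite complexReM -mulNr.
under [X in _ - charge_integral (Im_charge mu) X]eq_fun do rewrite complexImM.
under [X in charge_integral (Re_charge mu) X + _]eq_fun do rewrite complexImM.
under [X in _ + charge_integral (Im_charge mu) X]eq_fun do rewrite complexReM -mulNr.
apply: complex_ext; rewrite ?complexReM ?complexImM/= !charge_integralD
    ?charge_integralZ//;
  do ?exact: bounded_measurableZ; ring.
Qed.

Lemma Mb_integral_sum mu (I : Type) (s : seq I) (F : I -> S -> R[i]) :
  (forall i, bounded_borel (F i)) ->
  Mb_integral mu (fun x => \sum_(i <- s) F i x) =
  \sum_(i <- s) Mb_integral mu (F i).
Proof.
move=> bF; elim: s => [|i s IH].
  rewrite big_nil; under eq_fun do rewrite big_nil -(mul0r 0).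
  by rewrite Mb_integralZ ?mul0r//; exact: bounded_borel_cst.
rewrite big_cons -IH -Mb_integralD//; last exact: bounded_borel_sum.
by under eq_fun do rewrite big_cons.
Qed.

Lemma Mb_integralB mu f g : bounded_borel f -> bounded_borel g ->
  Mb_integral mu (fun x => f x - g x) = Mb_integral mu f - Mb_integral mu g.
Proof.
move=> bf bg; rewrite -[- Mb_integral mu g]mulN1r -Mb_integralZ//.
rewrite -Mb_integralD//; last exact: bounded_borelZ.
by under [in RHS]eq_fun do rewrite mulN1r.
Qed.

Lemma Mb_integral_indic mu A : measurable A ->
  Mb_integral mu (fun x => (\1_A x)%:C) = mu A.
Proof.
move=> mA; rewrite /Mb_integral /=.
have ci0 (nu : {charge set (borel S) -> \bar R}) : charge_integral nu (fun=> 0) = 0.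
  have := charge_integralZ nu 0 (@bounded_measurable_cst R _ (borel S) 0).
  by rewrite !mul0r.
rewrite !ci0 !charge_integral_indic// subr0 add0r /=.
by case: (mu A).
Qed.

Lemma Mb_integral_step mu (I : finType) (q : S -> I) (c : I -> R[i]) :
  borel_partition q ->
  Mb_integral mu (fun x => c (q x)) = \sum_i c i * mu (q @^-1` [set i]).
Proof.
move=> mq; rewrite step_funE Mb_integral_sum => [|i]; last first.
  exact/bounded_borelZ/bounded_borel_indic.
apply: eq_bigr => i _; rewrite Mb_integralZ; last exact: bounded_borel_indic.
by rewrite Mb_integral_indic.
Qed.

(** A crude constant: the sharp one, the total variation, is obtained in
    [Mb_integral_le] by approximation with step functions. *)
Definition Mb_mass mu : R :=
  2 * (charge_mass (Re_charge mu) + charge_mass (Im_charge mu)).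

Lemma Mb_mass_ge0 mu : 0 <= Mb_mass mu.
Proof. by rewrite mulr_ge0// addr_ge0// charge_mass_ge0. Qed.

Lemma Mb_integral_le_mass mu f M : bounded_borel f ->
  (forall x, normc (f x) <= M) -> normc (Mb_integral mu f) <= M * Mb_mass mu.
Proof.
move=> [bR bI] fM; apply: le_trans (normc_le_ReIm _) _.
have rM x : `|complex.Re (f x)| <= M by apply: le_trans (fM x); exact: ler_Re_normc.
have iM x : `|complex.Im (f x)| <= M by apply: le_trans (fM x); exact: ler_Im_normc.
rewrite /Mb_integral/=.
(* Each charge occurs in both the real and the imaginary part of the integral, whence the factor 2
   in [Mb_mass]. *)
have -> : M * Mb_mass mu =
    (M * charge_mass (Re_charge mu) + M * charge_mass (Im_charge mu)) +
    (M * charge_mass (Re_charge mu) + M * charge_mass (Im_charge mu)).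
  by rewrite /Mb_mass; ring.
apply: lerD.
  by apply: le_trans (ler_normB _ _) _; apply: lerD; exact: charge_integral_le.
by apply: le_trans (ler_normD _ _) _; apply: lerD; exact: charge_integral_le.
Qed.

Definition tvar mu A : R := fine (Defs.total_variation mu A).

Lemma tvar_fin_num mu A : Defs.total_variation mu A \is a fin_num.
Proof.
rewrite ge0_fin_numE ?tv_ge0//.
by apply: le_lt_trans (tv_subset _ (@subsetT _ A)) (radon_bounded (Mb_radon mu)).
Qed.

Lemma tvar_ge0 mu A : 0 <= tvar mu A.
Proof. by rewrite fine_ge0// tv_ge0. Qed.

Lemma tvar_subset mu A B : A `<=` B -> tvar mu A <= tvar mu B.
Proof.
by move=> AB; rewrite fine_le ?tvar_fin_num//; exact: tv_subset.
Qed.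

Lemma Mb_normE mu : `|mu| = (tvar mu setT)%:C.
Proof. by []. Qed.

Lemma tvar_inner mu A (e : R) : measurable A -> 0 < e ->
  exists K : set S, [/\ compact K, K `<=` A & tvar mu (A `\` K) < e].
Proof.
move=> mA e0; have [K [cK KA Ke]] := radon_regular (Mb_radon mu) mA e0.
by exists K; split => //; rewrite -lte_fin fineK ?tvar_fin_num.
Qed.

(** [total_variation] counts the first [n] terms of a sequence; the finite family is enumerated and
    continued by empty sets. *)
Lemma tvar_ge mu A (I : finType) (B : I -> set (borel S)) :
  trivIset setT B -> (forall i, measurable (B i)) -> (forall i, B i `<=` A) ->
  \sum_i normc (mu (B i)) <= tvar mu A.
Proof.
move=> tB mB BA; rewrite -lee_fin fineK ?tvar_fin_num//.
pose B' (k : nat) : set (borel S) :=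
  if insub k is Some i then B (enum_val (i : 'I_#|I|)) else set0.
have B'E (i : 'I_#|I|) : B' i = B (enum_val i) by rewrite /B' valK.
have -> : \sum_i normc (mu (B i)) = \sum_(i < #|I|) normc (mu (B' i)).
  rewrite (reindex (@enum_val I I)) /=; last first.
    by apply: onW_bij; exact: enum_val_bij.
  by apply: eq_bigr => i _; rewrite B'E.
apply: tv_ge => [|k|k].
- apply/trivIsetP => j k _ _ jk; rewrite /B'.
  case: insubP => [j' _ jE|_]; last by rewrite set0I.
  case: insubP => [k' _ kE|_]; last by rewrite setI0.
  move/trivIsetP : tB; apply => //; apply: contra jk => /eqP/enum_val_inj jk'.
  by rewrite -jE -kE jk'.
- by rewrite /B'; case: insub.
- by rewrite /B'; case: insub.
Qed.

(** This is how regularity is exploited later: [f] is small on a compact [A] and merely bounded off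
    it. For the proof, [f] is approximated by a step function whose partition also records
    membership in [A]; its coefficients are values of [f], so they obey the bounds [a] and [b], and
    the uniformly small remainder is absorbed by the crude constant [Mb_mass]. *)
Lemma Mb_integral_le2 mu f A (a b : R) : measurable A -> bounded_borel f ->
  0 <= a -> 0 <= b -> (forall x, A x -> normc (f x) <= a) ->
  (forall x, ~ A x -> normc (f x) <= b) ->
  normc (Mb_integral mu f) <= a * tvar mu A + b * tvar mu (~` A).
Proof.
move=> mA bf a0 b0 fa fb; apply/ler_addgt0Pr => e e0.
have d0 : 0 < 1 + Mb_mass mu by rewrite ltr_pwDl// Mb_mass_ge0.
have ed0 : 0 < e / (1 + Mb_mass mu) by rewrite divr_gt0.
have [I [q [mq oq]]] := oscillation_partition ed0 bf.
pose r x := (q x, x \in A).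
have mr : borel_partition r.
  by apply: borel_partition_pair => //; exact: borel_partition_mem.
have /choice[c cP] : forall i, exists z, (forall x, r x = i ->
    normc (f x - z) <= e / (1 + Mb_mass mu)) /\ normc z <= if i.2 then a else b.
  move=> i; have [[y ry]|noy] := pselect (exists y, r y = i).
    exists (f y); split => [x rx|]; first by apply: oq; move: rx; rewrite -ry => -[].
    rewrite -ry/=; case: ifPn => [/set_mem/fa//|/negP yA]; apply: fb => Ay.
    exact/yA/mem_set.
  exists 0; split=> [x rx|]; first by exfalso; apply: noy; exists x.
  by rewrite normc0; case: ifP.
have bc : bounded_borel (fun x => c (r x)) by exact: bounded_borel_step.
have -> : Mb_integral mu f =
    Mb_integral mu (fun x => c (r x)) + Mb_integral mu (fun x => f x - c (r x)).
  by rewrite Mb_integralB// addrC subrK.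
apply: le_trans (le_normcD _ _) _; apply: lerD; last first.
  apply: le_trans (Mb_integral_le_mass mu (bounded_borelB bf bc) _) _.
    by move=> x; apply: (cP (r x)).1.
  by rewrite mulrAC ler_pdivrMr// ler_pM2l// lerDr.
rewrite Mb_integral_step//; apply: le_trans (normc_sum _ _ _) _.
under eq_bigr do rewrite normcM.
have -> : \sum_i normc (c i) * normc (mu (r @^-1` [set i])) =
    \sum_i \sum_(j : bool) normc (c (i, j)) * normc (mu (r @^-1` [set (i, j)])).
  by rewrite pair_bigA; apply: eq_bigr => -[].
under eq_bigr do rewrite big_bool/=.
rewrite big_split/=.
have fibre (j : bool) (D : set (borel S)) : (forall x, (x \in A) = j -> D x) ->
    \sum_i normc (mu (r @^-1` [set (i, j)])) <= tvar mu D.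
  move=> AD; apply: tvar_ge => [|i|i x [_]]; [|exact: mr|exact: AD].
  apply/trivIsetP => i k _ _ /eqP ik; rewrite -subset0 => x [[qi _] [qk _]].
  by apply: ik; rewrite -qi.
apply: lerD.
  apply: (@le_trans _ _ (\sum_i a * normc (mu (r @^-1` [set (i, true)])))).
    by apply: ler_sum => i _; rewrite ler_wpM2r ?normc_ge0// (cP (i, true)).2.
  by rewrite -mulr_sumr ler_wpM2l// fibre// => x /set_mem.
apply: (@le_trans _ _ (\sum_i b * normc (mu (r @^-1` [set (i, false)])))).
  by apply: ler_sum => i _; rewrite ler_wpM2r ?normc_ge0// (cP (i, false)).2.
by rewrite -mulr_sumr ler_wpM2l// fibre// => x /negbT/negP xA /mem_set.
Qed.

Lemma Mb_integral_le mu f M : bounded_borel f -> (forall x, normc (f x) <= M) ->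
  normc (Mb_integral mu f) <= M * tvar mu setT.
Proof.
move=> bf fM; have M0 : 0 <= M := le_trans (normc_ge0 _) (fM point).
have := @Mb_integral_le2 mu f setT M 0 measurableT bf M0 (lexx 0).
by rewrite mul0r addr0; apply => // x /(_ I).
Qed.

(** Step functions are uniformly dense, so additivity and a bound by the sup norm reduce the
    vanishing of [J] to multiples of indicators. [J] will be the difference of the two sides of an
    identity, and any finite [D] will do. *)
Lemma step_ext (J : (S -> R[i]) -> R[i]) (D : R) :
  (forall f g, bounded_borel f -> bounded_borel g ->
    J (fun x => f x + g x) = J f + J g) ->
  (forall c A, measurable A -> J (fun x => c * (\1_A x)%:C) = 0) ->
  (forall f M, bounded_borel f -> (forall x, normc (f x) <= M) ->
    normc (J f) <= M * D) ->
  forall f, bounded_borel f -> J f = 0.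
Proof.
move=> JD J0 Jle f bf; apply: normc_eq0_le => e e0.
have d0 : 0 < 1 + `|D| by rewrite ltr_pwDl.
have ed0 : 0 < e / (1 + `|D|) by rewrite divr_gt0.
have [I [q [c [mq fc]]]] := step_approximation ed0 bf.
have bc : bounded_borel (fun x => c (q x)) by exact: bounded_borel_step.
have bfc := bounded_borelB bf bc.
have bT i := bounded_borelZ (c i) (bounded_borel_indic R (mq i)).
have Jc : J (fun x => c (q x)) = 0.
  rewrite step_funE; elim: (index_enum I) => [|i s IH].
    have := J0 0 set0 measurable0; under eq_fun do rewrite mul0r.
    by under [X in _ -> J X = _]eq_fun do rewrite big_nil.
  under eq_fun do rewrite big_cons.
  by rewrite JD ?J0 ?IH ?addr0//; exact: bounded_borel_sum.
have -> : J f = J (fun x => f x - c (q x)).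
  rewrite -[RHS]addr0 -Jc -JD//; congr J.
  by apply/funext => x; rewrite subrK.
apply: le_trans (Jle _ _ bfc fc) _.
rewrite mulrAC ler_pdivrMr// ler_pM2l//.
by apply: le_trans (ler_norm _) _; rewrite lerDr.
Qed.

(** The Hahn decompositions chosen for [c *: mu + nu], [mu] and [nu] are unrelated, so the identity
    is not inherited from the defining integrals; on indicators it is the definition of the linear
    combination. *)
Lemma Mb_integral_linear_measure (c : R[i]) mu nu f : bounded_borel f ->
  Mb_integral (c *: mu + nu) f = c * Mb_integral mu f + Mb_integral nu f.
Proof.
move=> bf; apply/eqP; rewrite -subr_eq0; apply/eqP; move: f bf.
apply: (@step_ext _ (tvar (c *: mu + nu) setT +
  (normc c * tvar mu setT + tvar nu setT))).
- by move=> f g bf bg; rewrite !Mb_integralD// mulrDr; ring.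
- move=> z A mA; rewrite !Mb_integralZ ?Mb_integral_indic//;
    do ?exact: bounded_borel_indic.
  rewrite -[(c *: mu + nu : Mb R S) A]/(c * mu A + nu A); ring.
- move=> f M bf fM; apply: le_trans (le_normcD _ _) _; rewrite normcN.
  rewrite mulrDr; apply: lerD; first exact: Mb_integral_le.
  apply: le_trans (le_normcD _ _) _; rewrite normcM mulrDr.
  apply: lerD; last exact: Mb_integral_le.
  by rewrite mulrCA ler_wpM2l ?normc_ge0//; exact: Mb_integral_le.
Qed.

End Mb_integral_theory.

(** * Lusin approximation and isometry *)

Section complex_topology.
Context (R : realType).
Local Open Scope complex_scope.

Lemma ge0_complexE (z : R[i]) : 0 <= z -> z = (complex.Re z)%:C /\ 0 <= complex.Re z.
Proof. by case: z => a b; rewrite lecE/= => /andP[/eqP -> a0]. Qed.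

Lemma gt0_complexE (z : R[i]) : 0 < z -> z = (complex.Re z)%:C /\ 0 < complex.Re z.
Proof. by case: z => a b; rewrite ltcE/= => /andP[/eqP -> a0]. Qed.

Lemma continuous_normcP (T : topologicalType) (f : T -> R[i]^o) :
  continuous f <-> forall x (e : R), 0 < e ->
    \forall y \near x, normc (f x - f y) <= e.
Proof.
split=> [cf x e e0|cf x].
  have /(@cvgrPdist_le _ _ _ (nbhs x) (nbhs_filter x)) /(_ e%:C) := cf x.
  rewrite ltcR => /(_ e0); apply: filterS => y.
  by rewrite -lecR.
apply/(@cvgrPdist_le _ _ _ (nbhs x) (nbhs_filter x)) => e /gt0_complexE[-> e0].
by apply: filterS (cf x _ e0) => y; rewrite -lecR.
Qed.

End complex_topology.

Section C0_theory.
Context (R : realType) (S : ptopologicalType).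
Local Open Scope complex_scope.
Implicit Types (f g : C0 R S).

Lemma C0_continuous f : continuous (f : S -> R[i]^o).
Proof. by have /asboolP[] := C0_funP f. Qed.

Lemma C0_vanishes f : vanishes_at_infinity f.
Proof. by have /asboolP[] := C0_funP f. Qed.

Definition C0_sup f : R := sup [set normc (f x) | x in [set: S]].

Lemma C0_normE f : `|f| = (C0_sup f)%:C.
Proof. by []. Qed.

Lemma C0_sup_ge f x : normc (f x) <= C0_sup f.
Proof. exact: C0_normcP. Qed.

Lemma C0_sup_ge0 f : 0 <= C0_sup f.
Proof. exact: le_trans (normc_ge0 _) (C0_sup_ge f point). Qed.

Lemma C0_sup_le f M : (forall x, normc (f x) <= M) -> C0_sup f <= M.
Proof. exact: C0_norm_le. Qed.

Lemma bounded_continuous_borel (f : S -> R[i]) (M : R) :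
  continuous (f : S -> R[i]^o) -> (forall x, normc (f x) <= M) ->
  bounded_borel f.
Proof.
move=> cf fM; apply: bounded_borelP; last by exists M.
  apply: continuous_borel => x.
  by apply: (@continuous_comp _ R[i]^o R f); [exact: cf|exact: Re_continuous].
apply: continuous_borel => x.
by apply: (@continuous_comp _ R[i]^o R f); [exact: cf|exact: Im_continuous].
Qed.

Lemma C0_bounded_borel f : bounded_borel f.
Proof. exact: (@bounded_continuous_borel f _ (@C0_continuous f) (C0_sup_ge f)). Qed.

Lemma C0_addE f g x : (f + g) x = f x + g x.
Proof. by []. Qed.

Lemma C0_scaleE (c : R[i]) f x : (c *: f) x = c * f x.
Proof. by []. Qed.

Lemma C0_sumE (I : Type) (s : seq I) (F : I -> C0 R S) x :
  (\sum_(i <- s) F i) x = \sum_(i <- s) F i x.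
Proof. by elim/big_rec2 : _ => // i y z _ <-. Qed.

Lemma C0_ext f g : (forall x, f x = g x) -> f = g.
Proof. by move=> fg; apply/val_inj/funext. Qed.

Lemma continuous_real_complex (f : S -> R) : continuous f ->
  continuous ((fun x => (f x)%:C) : S -> R[i]^o).
Proof.
move=> cf; apply/continuous_normcP => x e e0.
have /cvgrPdist_le/(_ e e0) := cf x; apply: filterS => y.
by rewrite -(rmorphB (real_complex R)) normc_real.
Qed.

Lemma C0_of_nneg_subproof (f : S -> R) : C0nneg f ->
  ((fun x => (f x)%:C) : S -> R[i]^o) \in @C0_pred R S.
Proof.
move=> [cf f0 vf]; apply/asboolP; split; first exact: continuous_real_complex.
move=> e e0; rewrite (_ : [set _ | _] = [set x | e <= f x]); first exact: vf.
by apply/funext => x; rewrite /mkset normc_real ger0_norm.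
Qed.

Definition C0_of_nneg (f : S -> R) (Cf : C0nneg f) : C0 R S :=
  MkC0 (C0_of_nneg_subproof Cf).

End C0_theory.

Section duality.
Context (R : realType) (S : ptopologicalType).
Hypothesis S_hausdorff : hausdorff_space S.
Hypothesis S_lcompact : locally_compact [set: S].
Local Open Scope complex_scope.
Implicit Types (mu : Mb R S).

(** Inside each fibre a compact [K i] misses little variation. Urysohn functions [g i], equal to 1
    on [K i] and to 0 on the other [K j], are normalized so that their sum is at most 1; the
    combination with coefficients [c i] has modulus at most 1 and agrees with the step function on
    every [K i]. *)
Lemma lusin_step mu (I : finType) (q : S -> I) (c : I -> R[i]) (e : R) :
  borel_partition q -> (forall i, normc (c i) <= 1) -> 0 < e ->
  exists f : C0 R S, (forall x, normc (f x) <= 1) /\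
    normc (Mb_integral mu (fun x => c (q x)) - Mb_integral mu f) <= e.
Proof.
move=> mq c1 e0.
(* On a fibre, the integrand is bounded by 2 off [K i], and the errors of [#|I|] fibres add up. *)
have d0 : 0 < 2 * (1 + #|I|%:R : R) by rewrite mulr_gt0// ltr_pwDl// ler0n.
have ed0 : 0 < e / (2 * (1 + #|I|%:R)) by rewrite divr_gt0.
have /choice[K KP] : forall i, exists K : set S, [/\ compact K, K `<=` q @^-1` [set i] &
    tvar mu (q @^-1` [set i] `\` K) < e / (2 * (1 + #|I|%:R))].
  by move=> i; exact: tvar_inner (mq i) ed0.
have kK i : compact (K i) by case: (KP i).
have qK i x : K i x -> q x = i by case: (KP i) => _ + _; apply.
pose L i := \bigcup_(j in [set j | j != i]) K j.
have cL i : closed (L i).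
  apply: (compact_closed S_hausdorff).
  rewrite /L (_ : [set j | j != i] = [set` predC1 i]) ?bigcup_pred//.
  exact: bigsetU_compact.
have /choice[g gP] : forall i, exists g : S -> R, [/\ C0nneg g, forall x, g x <= 1,
    forall x, K i x -> g x = 1 & forall x, L i x -> g x = 0].
  move=> i; apply: urysohn_compact_closed => // x /qK qx [j /= ji /qK qj].
  by rewrite -qx -qj eqxx in ji.
have Cg i : C0nneg (g i) by case: (gP i).
have cg i := C0nneg_continuous (Cg i).
pose s x := \sum_i g i x.
have cs : continuous s by exact: continuous_sumf.
(* Dividing by [max 1 s] instead of [s] keeps [w] continuous where [s] vanishes, and [w] is still 1
   on the sets [K i], where [s] is 1. *)
pose w x := (Num.max 1 (s x))^-1.
have max_gt0 x : 0 < Num.max 1 (s x) by rewrite lt_max ltr01.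
have cm : continuous (fun x => Num.max 1 (s x)).
  by apply: continuous_maxf => //; exact: cst_continuous.
have cw : continuous w by move=> x; apply: cvgV; [rewrite gt_eqF|exact: cm].
have w01 x : 0 <= w x <= 1.
  by rewrite invr_ge0 (ltW (max_gt0 x))/= invf_le1// le_max lexx.
have Ch i : C0nneg (fun x => w x * g i x) by exact: C0nneg_mull.
have h_sum x : \sum_i w x * g i x <= 1.
  by rewrite -mulr_sumr mulrC ler_pdivrMr// mul1r le_max lexx orbT.
exists (\sum_i c i *: C0_of_nneg (Ch i)).
have fE x : (\sum_i c i *: C0_of_nneg (Ch i)) x = \sum_i c i * (w x * g i x)%:C.
  by rewrite C0_sumE.
have f1 x : normc ((\sum_i c i *: C0_of_nneg (Ch i)) x) <= 1.
  rewrite fE; apply: le_trans (normc_sum _ _ _) _; apply: le_trans (h_sum x).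
  apply: ler_sum => i _; rewrite normcM normc_real ger0_norm ?(C0nneg_ge0 (Ch i) x)//.
  by rewrite ler_piMl// (C0nneg_ge0 (Ch i) x).
have fK i x : K i x -> (\sum_i c i *: C0_of_nneg (Ch i)) x = c i.
  move=> Kx; have gx j : g j x = (j == i)%:R.
    case: eqVneq => [->|ji]; first by case: (gP i) => _ _ ->.
    by case: (gP j) => _ _ _ -> //; exists i => //=; rewrite eq_sym.
  have sx : s x = 1.
    rewrite /s (bigD1 i)//= gx eqxx big1 ?addr0// => j ji.
    by rewrite gx (negbTE ji).
  rewrite fE (bigD1 i)//= gx eqxx /w sx maxxx invr1 mulr1 mulr1.
  rewrite big1 ?addr0// => j ji.
  by rewrite gx (negbTE ji) mulr0 mulr0.
split => //.
move: f1 fK; set f := \sum_i c i *: C0_of_nneg (Ch i) => f1 fK.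
have bc : bounded_borel (fun x => c (q x)) by exact: bounded_borel_step.
have bf := C0_bounded_borel f.
have bu := bounded_borelB bc bf.
have b1 i := bounded_borel_indic R (mq i).
rewrite -Mb_integralB//.
rewrite (_ : (fun x => c (q x) - f x) =
    (fun x => \sum_i (c (q x) - f x) * (\1_(q @^-1` [set i]) x)%:C)); last first.
  apply/funext => x; rewrite -mulr_sumr [X in _ = _ * X](_ : _ = 1) ?mulr1//.
  by have := congr1 (@^~ x) (@step_funE R S I q (fun=> 1)) => /= {1}->;
    apply: eq_bigr => i _; rewrite mul1r.
rewrite Mb_integral_sum => [|i]; last exact: bounded_borelM.
apply: le_trans (normc_sum _ _ _) _.
apply: (@le_trans _ _ (\sum_(i : I) 2 * (e / (2 * (1 + #|I|%:R))))).
  apply: ler_sum => i _.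
  have mD : measurable (q @^-1` [set i] `\` K i : set (borel S)).
    by apply: measurableD; [exact: mq|exact: compact_borel].
  have := @Mb_integral_le2 _ _ mu _ _ 2 0 mD (bounded_borelM bu (b1 i))
    (ler0n _ 2) (lexx 0).
  rewrite mul0r addr0 => /(_ _ _)/le_trans; apply.
  - move=> x _; rewrite normcM normc_real indicE.
    apply: (@le_trans _ _ (2 * 1)); last by rewrite mulr1.
    apply: ler_pM => //; first exact: normc_ge0.
      apply: le_trans (le_normcD _ _) _; rewrite normcN.
      by rewrite (_ : 2 = 1 + 1) ?lerD.
    by case: (_ \in _); rewrite ?normr0 ?normr1.
  - move=> x Dx; have [qx|qx] := pselect ((q @^-1` [set i]) x); last first.
      by rewrite indicE memNset// mulr0 normc0.
    have [Kx|Kx] := pselect (K i x); last by exfalso; apply: Dx.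
    by rewrite (fK i)// (qK i)// subrr mul0r normc0.
  - by rewrite ler_pM2l// ltW//; case: (KP i).
rewrite sumr_const -[leLHS]mulr_natr invfM (mulrCA 2) [2 * (_ * _)]mulrA mulfV ?pnatr_eq0//.
by rewrite mul1r mulrAC ler_pdivrMr ?ltr_pwDl ?ler0n// ler_pM2l// lerDr.
Qed.

End duality.

Section isometry.
Context (R : realType) (S : ptopologicalType).
Hypothesis S_hausdorff : hausdorff_space S.
Hypothesis S_lcompact : locally_compact [set: S].
Local Open Scope complex_scope.
Implicit Types (mu : Mb R S).

Lemma normc_phase (z : R[i]) :
  exists2 w, normc w <= 1 & w * z = (normc z)%:C.
Proof.
have [->|z0] := eqVneq z 0; first by exists 0; rewrite ?normc0 ?mulr0.
exists ((normc z)%:C / z); last by rewrite mulfVK.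
rewrite normcM normc_real normcV (ger0_norm (normc_ge0 z)) mulfV//.
by apply: contra z0 => /eqP/eq0_normc ->.
Qed.

(** For disjoint sets [B i], the step function whose value on [B i] rotates [mu (B i)] to its
    modulus integrates to the sum of the moduli; [lusin_step] replaces it by a function of [C0] of
    norm at most 1. *)
Lemma tvar_le_dual mu (M : R) :
  (forall f : C0 R S, normc (Mb_integral mu f) <= M * C0_sup f) ->
  0 <= M -> tvar mu setT <= M.
Proof.
move=> muM M0; rewrite -lee_fin fineK ?tvar_fin_num//.
apply: tv_le => n B tB mB _; rewrite lee_fin; apply/ler_addgt0Pr => e e0.
(* The extra label [ord_max] collects the points outside the first [n] sets; its term in the
   integral will be 0. *)
pose q x : 'I_n.+1 :=
  if [pick i : 'I_n | x \in B i] is Some i then widen_ord (leqnSn n) i else ord_max.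
have qB (i : 'I_n) x : B i x -> q x = widen_ord (leqnSn n) i.
  move=> Bx; rewrite /q; case: pickP => [j Bj|/(_ i)]; last by rewrite mem_set.
  congr widen_ord; apply: val_inj => /=; apply: contrapT => /eqP ji.
  move/trivIsetP : tB => /(_ j i I I ji); rewrite -subset0 => /(_ x); apply; split => //.
  exact: set_mem Bj.
have Bq (i : 'I_n) x : q x = widen_ord (leqnSn n) i -> B i x.
  rewrite /q; case: pickP => [j Bj|_]; last first.
    by move=> /(congr1 val)/= ni; have := ltn_ord i; rewrite -ni ltnn.
  by move=> /(congr1 val)/= ji; rewrite -ji; exact: set_mem.
have qE (i : 'I_n) : q @^-1` [set widen_ord (leqnSn n) i] = B i.
  by apply/seteqP; split => x /=; [exact: Bq|exact: qB].
have mq : borel_partition q.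
  move=> k; have [kn|kn] := ltnP k n.
    have kE : k = widen_ord (leqnSn n) (Ordinal kn) by exact: val_inj.
    by rewrite kE qE.
  rewrite (_ : q @^-1` _ = ~` \bigcup_(i < n) B i).
    by apply: measurableC; apply: bigcup_measurable.
  have kmax : k = ord_max by apply/val_inj/eqP; rewrite eqn_leq kn -ltnS ltn_ord.
  apply/seteqP; split => [x qx [i/= ni Bx]|x nB /=].
    move: (@qB (Ordinal ni) x Bx); rewrite (_ : q x = ord_max) -?kmax//.
    by move=> /(congr1 val)/= ki; move: ni; rewrite -ki ltnNge kn.
  rewrite /q; case: pickP => [j Bj|//]; exfalso; apply: nB.
  by exists j => //=; exact: set_mem.
have /choice[c cP] : forall k : 'I_n.+1, exists z : R[i], normc z <= 1 /\
    z * mu (q @^-1` [set k]) = if (k < n)%N then (normc (mu (B k)))%:C else 0.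
  move=> k; have [kn|kn] := ltnP k n; last by exists 0; rewrite mul0r normc0.
  have kE : k = widen_ord (leqnSn n) (Ordinal kn) by exact: val_inj.
  by rewrite kE qE; have [w] := normc_phase (mu (B k)); exists w.
have [f [f1 fe]] :=
  lusin_step S_hausdorff S_lcompact mu mq (fun k => (cP k).1) e0.
have cB : Mb_integral mu (fun x => c (q x)) = (\sum_(i < n) normc (mu (B i)))%:C.
  rewrite Mb_integral_step// big_ord_recr/= (cP ord_max).2/= ltnn addr0 rmorph_sum.
  by apply: eq_bigr => i _; rewrite (cP _).2/= ltn_ord.
have -> : \sum_(i < n) normc (mu (B i)) = normc (Mb_integral mu (fun x => c (q x))).
  by rewrite cB normc_real ger0_norm// sumr_ge0// => i _; exact: normc_ge0.
rewrite -(subrK (Mb_integral mu f) (Mb_integral _ _)).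
apply: le_trans (le_normcD _ _) _; rewrite addrC lerD//.
apply: le_trans (muM f) _; rewrite -[leRHS]mulr1 ler_wpM2l//.
exact: C0_sup_le.
Qed.

End isometry.

(** * Finite positive measures as complex Radon measures *)

Section positive_measure.
Context (R : realType) (S : ptopologicalType).
Hypothesis S_hausdorff : hausdorff_space S.
Local Open Scope complex_scope.
Variable m : {finite_measure set (borel S) -> \bar R}.
Hypothesis m_inner : forall (A : set (borel S)) (e : R), measurable A -> 0 < e ->
  exists K : set S, [/\ compact K, K `<=` A & (m (A `\` K) < e%:E)%E].

Let mfin A : measurable A -> m A \is a fin_num.
Proof. exact: fin_num_measure. Qed.

Definition complex_of_measure (A : set (borel S)) : R[i]^o :=
  if `[< measurable A >] then (fine (m A))%:C else 0.

Let cmE A : measurable A -> complex_of_measure A = (fine (m A))%:C.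
Proof. by move=> mA; rewrite /complex_of_measure asboolT. Qed.

Let tv_cm (A : set (borel S)) : measurable A ->
  (Defs.total_variation complex_of_measure A <= m A)%E.
Proof.
move=> mA; apply: tv_le => n B tB mB BA.
rewrite (eq_bigr (fun i : 'I_n => fine (m (B i)))); last first.
  by move=> i _; rewrite cmE// normc_real ger0_norm// fine_ge0.
rewrite sum_fine => [|i _]; last exact: mfin.
rewrite -measure_bigsetU// fineK; last first.
  by apply: mfin; exact: bigsetU_measurable.
apply: le_measure; [|exact: mem_set|].
  by apply: mem_set; apply: bigsetU_measurable => i _; exact: mB.
by rewrite -bigcup_mkord => x [i _ /BA].
Qed.

Lemma complex_of_measure_is_radon : is_radon complex_of_measure.
Proof.
split.
- move=> F mF tF; have mUF : measurable (\bigcup_i F i) by exact: bigcup_measurable.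
  rewrite cmE//; have /fine_cvgP[_ cF] :
      (fun n => (\sum_(0 <= i < n) m (F i))%E) @ \oo -->
      (fine (m (\bigcup_i F i)))%:E.
    by rewrite fineK ?mfin//; exact: measure_semi_sigma_additive.
  have cC : continuous ((fun x => x%:C) : R -> R[i]^o).
    by apply: (@continuous_real_complex R R idfun) => x; exact: cvg_id.
  have := cvg_comp _ _ cF (cC _).
  rewrite (_ : _ \o _ = fun n => \sum_(0 <= i < n) complex_of_measure (F i))//.
  apply/funext => n /=; rewrite -sum_fine => [|i _]; last exact: mfin.
  by rewrite rmorph_sum; apply: eq_bigr => i _; rewrite cmE.
- by apply: le_lt_trans (tv_cm measurableT) _; rewrite ltey_eq mfin.
- move=> A e mA e0; have [K [kK KA Ke]] := m_inner mA e0.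
  exists K; split => //; apply: le_lt_trans (tv_cm _) Ke.
  by apply: measurableD => //; exact: compact_borel.
- by move=> A nA; rewrite /complex_of_measure asboolF.
Qed.

Definition Mb_of_measure : Mb R S :=
  MkMb (introT (asboolP _) complex_of_measure_is_radon).

(** The Hahn decomposition chosen for the real part may have a nonempty null set as negative part,
    so both sides are compared on indicators through [step_ext]. *)
Lemma Mb_integral_of_measure (f : S -> R[i]) : bounded_borel f ->
  Mb_integral Mb_of_measure f =
  (\int[m]_x complex.Re (f x)) +i* (\int[m]_x complex.Im (f x)).
Proof.
move=> bf; apply/eqP; rewrite -subr_eq0; apply/eqP; move: f bf.
apply: (@step_ext _ _ _ (tvar Mb_of_measure setT +
  (fine (m setT) + fine (m setT)))).
- move=> f g /[dup] bf [rf mf] /[dup] bg [rg mg]; rewrite Mb_integralD//.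
  under eq_Rintegral do rewrite complexReD.
  under [X in _ +i* X]eq_Rintegral do rewrite complexImD.
  rewrite !bm_RintegralD//.
  by apply: complex_ext; rewrite !(complexReD, complexImD, complexReN, complexImN)/=;
    ring.
- move=> c A mA; have bA := bounded_measurable_indic R mA.
  rewrite Mb_integralZ; last exact: bounded_borel_indic.
  rewrite Mb_integral_indic// -[Mb_of_measure A]/(complex_of_measure A) cmE//.
  under eq_Rintegral do rewrite complexReM/= mulr0 subr0.
  under [X in _ +i* X]eq_Rintegral do rewrite complexImM/= mulr0 add0r.
  rewrite !bm_RintegralZ// Rintegral_indic//.
  by apply: complex_ext; rewrite !(complexReD, complexImD, complexReN, complexImN,
    complexReM, complexImM)/=; ring.
- move=> f M /[dup] bf [rf mf] fM; apply: le_trans (le_normcD _ _) _.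
  rewrite normcN mulrDr lerD//; first exact: Mb_integral_le.
  apply: le_trans (normc_le_ReIm _) _; rewrite /= mulrDr.
  apply: lerD; apply: bm_normr_Rintegral => // x; apply: le_trans (fM x).
    exact: ler_Re_normc.
  exact: ler_Im_normc.
Qed.

End positive_measure.

(** * Riesz representation of complex functionals *)

Section real_functional.
Context (R : realType) (S : ptopologicalType).
Hypothesis S_hausdorff : hausdorff_space S.
Hypothesis S_lcompact : locally_compact [set: S].
Local Open Scope complex_scope.

(** Junk value [0] when [h] is not in [C0]. *)
Definition real_C0 (h : S -> R) : C0 R S :=
  insubd (0 : C0 R S) (fun x => (h x)%:C : R[i]^o).

Lemma real_C0E (h : S -> R) x : C0nneg h -> real_C0 h x = (h x)%:C.
Proof. by move=> Ch; rewrite /real_C0 insubdK//; exact: C0_of_nneg_subproof. Qed.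

Lemma real_C0D (h k : S -> R) : C0nneg h -> C0nneg k ->
  real_C0 (fun x => h x + k x) = real_C0 h + real_C0 k.
Proof.
move=> Ch Ck; apply: C0_ext => x; rewrite C0_addE !real_C0E ?rmorphD//.
exact: C0nnegD.
Qed.

Lemma real_C0_sup (h : S -> R) M : C0nneg h -> (forall x, h x <= M) ->
  C0_sup (real_C0 h) <= M.
Proof.
move=> Ch hM; apply: C0_sup_le => x.
by rewrite real_C0E// normc_real ger0_norm// C0nneg_ge0.
Qed.

Variables (u : C0 R S -> R) (B : R).
Hypothesis uD : forall f g, u (f + g) = u f + u g.
Hypothesis u_le : forall f, `|u f| <= B * C0_sup f.
Hypothesis B_ge0 : 0 <= B.

Let below (h : S -> R) : set (S -> R) := [set g | C0nneg g /\ forall x, g x <= h x].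

(** The positive part of [u] in the order dual: [u = upos - (upos - u)] is the
    Jordan decomposition of the functional. *)
Let upos (h : S -> R) : R := sup [set u (real_C0 g) | g in below h].

Let u0 : u 0 = 0.
Proof.
have := uD 0 0; rewrite addr0 => /eqP.
by rewrite -subr_eq0 opprD addrA subrr sub0r oppr_eq0 => /eqP.
Qed.

Let u_real_le (h : S -> R) M : C0nneg h -> (forall x, h x <= M) ->
  `|u (real_C0 h)| <= B * M.
Proof.
by move=> Ch hM; apply: le_trans (u_le _) _; rewrite ler_wpM2l ?real_C0_sup.
Qed.

Let upos_has_sup h : C0nneg h -> has_sup [set u (real_C0 g) | g in below h].
Proof.
move=> Ch; split.
  exists (u (real_C0 (fun=> 0))), (fun=> 0) => //; split; first exact: C0nneg0.
  exact: C0nneg_ge0.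
exists (B * C0_sup (real_C0 h)) => _ [g [Cg gh] <-].
apply: le_trans (ler_norm _) (u_real_le Cg _) => x; apply: le_trans (gh x) _.
have := C0_sup_ge (real_C0 h) x.
by rewrite real_C0E// normc_real ger0_norm// C0nneg_ge0.
Qed.

Let upos_ge h g : C0nneg h -> C0nneg g -> (forall x, g x <= h x) ->
  u (real_C0 g) <= upos h.
Proof.
by move=> Ch Cg gh; apply: sup_ubound; [exact: (upos_has_sup Ch).2|exists g].
Qed.

Let upos_le h M : C0nneg h ->
  (forall g, C0nneg g -> (forall x, g x <= h x) -> u (real_C0 g) <= M) -> upos h <= M.
Proof.
move=> Ch hM; apply: sup_le_ub; first exact: (upos_has_sup Ch).1.
by move=> _ [g [Cg gh] <-]; exact: hM.
Qed.

Let real_C0_0 : real_C0 (fun=> 0) = 0.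
Proof. by apply: C0_ext => x; rewrite real_C0E//; exact: C0nneg0. Qed.

Let upos_ge0 h : C0nneg h -> 0 <= upos h.
Proof.
move=> Ch; rewrite -u0 -real_C0_0; apply: upos_ge => //; first exact: C0nneg0.
exact: C0nneg_ge0.
Qed.

(** Riesz decomposition: every [g] with [0 <= g <= h + k] is the sum of [min g h], which lies below
    [h], and of [g - min g h], which lies below [k]. *)
Let uposD h k : C0nneg h -> C0nneg k ->
  upos (fun x => h x + k x) = upos h + upos k.
Proof.
move=> Ch Ck; have Chk := C0nnegD Ch Ck.
apply/eqP; rewrite eq_le; apply/andP; split.
  apply: upos_le => // g Cg ghk.
  have Cm : C0nneg (fun x => Num.min (g x) (h x)) by exact: C0nneg_min.
  have Cgm : C0nneg (fun x => g x - Num.min (g x) (h x)).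
    by apply: C0nneg_sub => // x; rewrite ge_min lexx.
  rewrite (_ : g =
      fun x => Num.min (g x) (h x) + (g x - Num.min (g x) (h x))); last first.
    by apply/funext => x; rewrite addrC subrK.
  rewrite real_C0D// uD lerD//; apply: upos_ge => // x.
    by rewrite ge_min lexx orbT.
  rewrite lerBlDr; case: (leP (g x) (h x)) => _; last by rewrite addrC.
  by rewrite lerDr C0nneg_ge0.
rewrite -lerBrDr; apply: upos_le => // g Cg gh.
rewrite lerBrDr -lerBrDl; apply: upos_le => // l Cl lk.
rewrite lerBrDl -uD -real_C0D//; apply: upos_ge => //; first exact: C0nnegD.
by move=> x; rewrite lerD.
Qed.

Let upos_bound h M : C0nneg h -> (forall x, h x <= M) -> upos h <= B * M.
Proof.
move=> Ch hM; apply: upos_le => // g Cg gh.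
by apply: le_trans (ler_norm _) (u_real_le Cg _) => x; exact: le_trans (hM x).
Qed.

Let uneg h := upos h - u (real_C0 h).

Let unegD h k : C0nneg h -> C0nneg k ->
  uneg (fun x => h x + k x) = uneg h + uneg k.
Proof. by move=> Ch Ck; rewrite /uneg uposD// real_C0D// uD opprD addrACA. Qed.

Let uneg_ge0 h : C0nneg h -> 0 <= uneg h.
Proof. by move=> Ch; rewrite subr_ge0 upos_ge. Qed.

Let uneg_bound h M : C0nneg h -> (forall x, h x <= M) -> uneg h <= (B + B) * M.
Proof.
move=> Ch hM; rewrite mulrDl lerD ?upos_bound// lerNl.
by have := u_real_le Ch hM; rewrite ler_norml => /andP[].
Qed.

Lemma real_riesz : exists mu : Mb R S, forall h, C0nneg h ->
  Mb_integral mu (real_C0 h) = (u (real_C0 h))%:C.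
Proof.
have [m [mi mE]] :=
  positive_riesz S_hausdorff S_lcompact uposD upos_ge0 upos_bound.
have [n [ni nE]] :=
  positive_riesz S_hausdorff S_lcompact unegD uneg_ge0 uneg_bound.
exists (-1 *: Mb_of_measure S_hausdorff ni + Mb_of_measure S_hausdorff mi) => h Ch.
have bh := C0_bounded_borel (real_C0 h).
rewrite Mb_integral_linear_measure// !Mb_integral_of_measure//.
under eq_Rintegral do rewrite real_C0E//=.
under [X in _ +i* X]eq_Rintegral do rewrite real_C0E//=.
under [X in _ + X +i* _]eq_Rintegral do rewrite real_C0E//=.
under [X in _ + (_ +i* X)]eq_Rintegral do rewrite real_C0E//=.
rewrite mE// nE// !Rintegral_cst// !mul0r.
apply: complex_ext; rewrite !(complexReD, complexImD, complexReM, complexImM)/=.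
  by rewrite /uneg; ring.
ring.
Qed.

End real_functional.

Section complex_riesz.
Context (R : realType) (S : ptopologicalType).
Hypothesis S_hausdorff : hausdorff_space S.
Hypothesis S_lcompact : locally_compact [set: S].
Local Open Scope complex_scope.

Lemma C0nneg_pos_part (f : C0 R S) (k : S -> R) : continuous k ->
  (forall x, `|k x| <= normc (f x)) -> C0nneg (fun x => Num.max (k x) 0).
Proof.
move=> ck kf; have cm : continuous (fun x => Num.max (k x) 0).
  by apply: continuous_maxf => //; exact: cst_continuous.
split => // [x|e e0]; first by rewrite le_max lexx orbT.
apply: (subclosed_compact (closed_gef cm) (C0_vanishes e0)) => x /=.
by rewrite le_max [e <= 0]leNgt e0 orbF => /le_trans; apply;
  apply: le_trans (kf x); exact: ler_norm.
Qed.

(** The positive and negative parts of the real and imaginary parts are nested in the shape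
    [c *: f + g], on which linearity can be rewritten repeatedly. *)
Lemma C0_decomposition (f : C0 R S) : exists h1 h2 h3 h4 : S -> R,
  [/\ C0nneg h1, C0nneg h2, C0nneg h3 & C0nneg h4] /\
  f = -1 *: real_C0 h2 + ((0 +i* 1) *: real_C0 h3 +
      ((0 -i* 1) *: real_C0 h4 + real_C0 h1)).
Proof.
have cR : continuous (fun x => complex.Re (f x)).
  by move=> x; apply: (@continuous_comp _ R[i]^o R f);
    [exact: C0_continuous|exact: Re_continuous].
have cI : continuous (fun x => complex.Im (f x)).
  by move=> x; apply: (@continuous_comp _ R[i]^o R f);
    [exact: C0_continuous|exact: Im_continuous].
have C1 : C0nneg (fun x => Num.max (complex.Re (f x)) 0).
  by apply: (C0nneg_pos_part cR) => x; exact: ler_Re_normc.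
have C2 : C0nneg (fun x => Num.max (- complex.Re (f x)) 0).
  apply: (@C0nneg_pos_part f) => x; first by apply: cvgN; exact: cR.
  by rewrite normrN ler_Re_normc.
have C3 : C0nneg (fun x => Num.max (complex.Im (f x)) 0).
  by apply: (C0nneg_pos_part cI) => x; exact: ler_Im_normc.
have C4 : C0nneg (fun x => Num.max (- complex.Im (f x)) 0).
  apply: (@C0nneg_pos_part f) => x; first by apply: cvgN; exact: cI.
  by rewrite normrN ler_Im_normc.
eexists; eexists; eexists; eexists; split.
  by split; [exact: C1|exact: C2|exact: C3|exact: C4].
have posB (a : R) : Num.max a 0 - Num.max (- a) 0 = a.
  have [a0|/ltW a0] := leP 0 a; first by rewrite max_r ?subr0// oppr_le0.
  by rewrite max_l ?oppr_ge0// sub0r opprK.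
apply: C0_ext => x; rewrite !(C0_addE, C0_scaleE) !real_C0E//.
apply: complex_ext; rewrite !(complexReD, complexImD, complexReM, complexImM)/=.
  by rewrite -[LHS]posB; ring.
by rewrite -[LHS]posB; ring.
Qed.

Lemma C0_functional_ext (phi psi : C0 R S -> R[i]) :
  (forall (c : R[i]) f g, phi (c *: f + g) = c * phi f + phi g) ->
  (forall (c : R[i]) f g, psi (c *: f + g) = c * psi f + psi g) ->
  (forall h, C0nneg h -> phi (real_C0 h) = psi (real_C0 h)) -> phi =1 psi.
Proof.
move=> phiL psiL E f; have [h1 [h2 [h3 [h4 [[C1 C2 C3 C4] ->]]]]] := C0_decomposition f.
by rewrite !phiL !psiL !E.
Qed.

(** The representing measure is [mu + i nu], where [mu] and [nu] represent the real and the
    imaginary part of [phi] on the cone. These parts are not complex linear, but [phi] and the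
    integral are, so their agreement on the cone spreads to all of [C0]. *)
Theorem complex_riesz (phi : C0 R S -> R[i]) (B : R) :
  (forall (c : R[i]) f g, phi (c *: f + g) = c * phi f + phi g) ->
  0 <= B -> (forall f, normc (phi f) <= B * C0_sup f) ->
  exists mu : Mb R S, forall f : C0 R S, Mb_integral mu f = phi f.
Proof.
move=> phiL B0 phi_le.
have phiD (f g : C0 R S) : phi (f + g) = phi f + phi g.
  by rewrite -[f]scale1r phiL mul1r scale1r.
have [mu muE] : exists mu : Mb R S, forall h, C0nneg h ->
    Mb_integral mu (real_C0 h) = (complex.Re (phi (real_C0 h)))%:C.
  apply: (@real_riesz _ _ S_hausdorff S_lcompact (fun f => complex.Re (phi f)) B) => //.
    by move=> f g; rewrite phiD complexReD.
  by move=> f; apply: le_trans (phi_le f); exact: ler_Re_normc.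
have [nu nuE] : exists nu : Mb R S, forall h, C0nneg h ->
    Mb_integral nu (real_C0 h) = (complex.Im (phi (real_C0 h)))%:C.
  apply: (@real_riesz _ _ S_hausdorff S_lcompact (fun f => complex.Im (phi f)) B) => //.
    by move=> f g; rewrite phiD complexImD.
  by move=> f; apply: le_trans (phi_le f); exact: ler_Im_normc.
exists ((0 +i* 1) *: nu + mu); apply: C0_functional_ext => // [c f g|h Ch].
  rewrite Mb_integralD; [|exact: (C0_bounded_borel (c *: f))|exact: C0_bounded_borel].
  by rewrite Mb_integralZ//; exact: C0_bounded_borel.
rewrite Mb_integral_linear_measure; last exact: C0_bounded_borel.
rewrite muE// nuE//; apply: complex_ext;
  rewrite !(complexReD, complexImD, complexReM, complexImM)/=; ring.
Qed.

End complex_riesz.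

(** * Completeness and duality *)

Section completeness.
Context (R : realType).
Local Open Scope complex_scope.

Lemma complex_filter_complete (T : Type) (F : set_system T) (h : T -> R[i]) :
  ProperFilter F ->
  (forall e : R, 0 < e -> exists z, F [set t | normc (z - h t) <= e]) ->
  exists l, forall e : R, 0 < e -> F [set t | normc (l - h t) <= e].
Proof.
move=> PF Fh.
have part (p : R[i] -> R) : (forall z w, `|p z - p w| <= normc (z - w)) ->
    exists a, forall e : R, 0 < e -> F [set t | `|a - p (h t)| <= e].
  move=> pl; have : cvg ((p \o h) @ F).
    apply: R_complete; apply/cauchyP => e e0.
    have e20 : 0 < e / 2 by rewrite divr_gt0.
    have [z Fz] := Fh _ e20; exists (p z).
    suff : F [set t | ball (p z) e (p (h t))] by [].
    apply: filterS Fz => t /= zt; rewrite -ball_normE/=.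
    apply: le_lt_trans (pl _ _) _; apply: le_lt_trans zt _.
    by rewrite ltr_pdivrMr// ltr_pMr// ltr1n.
  move=> /cvg_ex[a Fa]; exists a => e e0.
  by have /cvgrPdist_le/(_ e e0) := Fa.
have [a Fa] : exists a, forall e : R, 0 < e ->
    F [set t | `|a - complex.Re (h t)| <= e].
  by apply: part => z w; rewrite -complexReN -complexReD; exact: ler_Re_normc.
have [b Fb] : exists b, forall e : R, 0 < e ->
    F [set t | `|b - complex.Im (h t)| <= e].
  by apply: part => z w; rewrite -complexImN -complexImD; exact: ler_Im_normc.
exists (a +i* b) => e e0; have e20 : 0 < e / 2 by rewrite divr_gt0.
apply: filterS (filterI (Fa _ e20) (Fb _ e20)) => t [/= at_ bt].
apply: le_trans (normc_le_ReIm _) _.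
by rewrite (splitr e) complexReD complexImD complexReN complexImN lerD.
Qed.

(** Completeness of a space of bounded functions, [x] being seen as the function
    [i |-> ev i x]. *)
Lemma complete_of_evaluations (V : normedModType R[i]) (nrm : V -> R) (I : Type)
    (ev : I -> V -> R[i]) (k : I -> R) :
  (forall x, `|x| = (nrm x)%:C) ->
  (forall i, 0 <= k i) ->
  (forall i x y, ev i (x - y) = ev i x - ev i y) ->
  (forall i x, normc (ev i x) <= nrm x * k i) ->
  (forall x e, 0 <= e -> (forall i, normc (ev i x) <= e * k i) -> nrm x <= e) ->
  (forall l : I -> R[i],
    (forall e : R, 0 < e -> exists y, forall i, normc (l i - ev i y) <= e * k i) ->
    exists v, forall i, ev i v = l i) ->
  is_complete V.
Proof.
move=> nrmE k0 evB ev_le le_ev attained F PF /cauchyP cF.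
have {}cF (e : R) : 0 < e -> exists x, F [set y | nrm (x - y) <= e].
  move=> e0; have [|x Fx] := cF e%:C; first by rewrite /= ltcR.
  exists x; apply: filterS Fx => y; rewrite -ball_normE/= nrmE ltcR.
  exact: ltW.
have /choice[l lP] : forall i, exists z, forall e : R, 0 < e ->
    F [set y | normc (z - ev i y) <= e].
  move=> i; apply: complex_filter_complete => e e0.
  have k1 : 0 < 1 + k i by rewrite ltr_pwDl.
  have [x Fx] := cF (e / (1 + k i)) (divr_gt0 e0 k1).
  exists (ev i x); apply: filterS Fx => y /= xy; rewrite -evB.
  apply: le_trans (ev_le _ _) _; apply: le_trans (ler_wpM2r (k0 i) xy) _.
  by rewrite mulrAC ler_pdivrMr// ler_pM2l// lerDr.
have unif (e : R) : 0 < e ->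
    F [set y | forall i, normc (l i - ev i y) <= e * k i].
  move=> e0; have e20 : 0 < e / 2 by rewrite divr_gt0.
  have [x Fx] := cF _ e20; apply: filterS (Fx) => y /= xy i.
  apply/ler_addgt0Pr => d d0.
  (* The auxiliary [z] may depend on [i], because the distances in norm from [x] to [y] and to [z],
     at most [e / 2], control all evaluations at once. *)
  have [z [/= xz lz]] := filter_ex (filterI Fx (lP i d d0)).
  rewrite (_ : l i - ev i y = (ev i x - ev i y) - (ev i x - ev i z) + (l i - ev i z)).
    apply: le_trans (le_normcD _ _) _; apply: lerD => //.
    apply: le_trans (le_normcD _ _) _; rewrite normcN -!evB (splitr e) mulrDl.
    by apply: lerD; apply: le_trans (ev_le _ _) _; exact: ler_wpM2r.
  by ring.
have [v vl] := attained l (fun e e0 => filter_ex (unif e e0)).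
apply/cvg_ex; exists v; apply/cvgrPdist_le => e /gt0_complexE[-> e0].
apply: filterS (unif _ e0) => y ly; rewrite nrmE lecR.
by apply: le_ev (ltW e0) _ => i; rewrite evB vl.
Qed.

End completeness.

Section predual.
Context (R : realType) (S : ptopologicalType).
Local Open Scope complex_scope.

Lemma C0_complete : is_complete (C0 R S).
Proof.
apply: (@complete_of_evaluations _ _ (@C0_sup R S) S (fun x f => f x) (fun=> 1)) => //.
- by move=> x f; rewrite mulr1; exact: C0_sup_ge.
- by move=> f e e0 fe; apply: C0_sup_le => x; rewrite -(mulr1 e).
move=> l lP.
have {}lP (e : R) : 0 < e ->
    exists y : C0 R S, forall x, normc (l x - y x) <= e.
  by move=> /lP[y ly]; exists y => x; rewrite -(mulr1 e).
have cl : continuous (l : S -> R[i]^o).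
  apply/continuous_normcP => x e e0.
  have e30 : 0 < e / 3 by rewrite divr_gt0.
  have [y ly] := lP _ e30.
  have /continuous_normcP/(_ x _ e30) := @C0_continuous _ _ y.
  apply: filterS => z yz.
  rewrite (_ : l x - l z = (l x - y x) + (y x - y z) - (l z - y z)); last by ring.
  rewrite (_ : e = e / 3 + e / 3 + e / 3); last by field.
  apply: le_trans (le_normcD _ _) _; rewrite normcN lerD//.
  by apply: le_trans (le_normcD _ _) _; rewrite lerD.
have vl : vanishes_at_infinity l.
  move=> e e0; have e20 : 0 < e / 2 by rewrite divr_gt0.
  have [y ly] := lP _ e20.
  apply: (subclosed_compact (@closed_normc_ge _ _ _ e cl) (@C0_vanishes _ _ y _ e20)).
  move=> x /=; rewrite {1}(splitr e) -lerBrDr => /le_trans; apply.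
  rewrite lerBlDr -[l x](subrK (y x)); apply: le_trans (le_normcD _ _) _.
  by rewrite addrC lerD2l.
have lC0 : (l : S -> R[i]^o) \in @C0_pred R S by apply/asboolP.
by exists (MkC0 lC0).
Qed.

Hypothesis S_hausdorff : hausdorff_space S.
Hypothesis S_lcompact : locally_compact [set: S].

Lemma C0_functional_bounded (phi : C0 R S -> R[i]^o) :
  linear phi -> continuous phi ->
  exists2 B : R, 0 <= B & forall f, normc (phi f) <= B * C0_sup f.
Proof.
move=> phiL cphi.
have phi0 : phi 0 = 0.
  by have := phiL (-1) 0 0; rewrite scaleN1r oppr0 addr0 scaleN1r addNr.
have phiZ (c : R[i]) f : phi (c *: f) = c * phi f.
  by have := phiL c f 0; rewrite addr0 phi0 addr0.
have /(@cvgrPdist_le _ _ _ (nbhs (0 : C0 R S)) (nbhs_filter _))/(_ 1 ltr01) := cphi 0.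
move=> /nbhs_ballP[r /gt0_complexE[rE d0]]; rewrite -ball_normE rE.
move: (complex.Re r) d0 => d d0 phid.
exists (2 / d) => [|f]; first by rewrite divr_ge0// ltW.
have phi1 g : C0_sup g < d -> normc (phi g) <= 1.
  move=> gd; have := phid g; rewrite /= phi0 !sub0r !normrN C0_normE ltcR => /(_ gd).
  by rewrite -lecR.
apply/ler_addgt0Pr => e e0.
(* Positive even when [f = 0], so that [f] can be rescaled; the extra term contributes exactly [e]
   to the bound [2 / d * s]. *)
pose s := C0_sup f + e * (d / 2).
have s0 : 0 < s by rewrite ltr_wpDl ?C0_sup_ge0// mulr_gt0// divr_gt0.
have ds0 : 0 < d / 2 / s by rewrite !divr_gt0.
have := phi1 ((d / 2 / s)%:C *: f).
rewrite phiZ normcM normc_real gtr0_norm// => H.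
have : d / 2 / s * normc (phi f) <= 1.
  apply: H; apply: (@le_lt_trans _ _ (d / 2)); last first.
    by rewrite ltr_pdivrMr// ltr_pMr// ltr1n.
  apply: C0_sup_le => x; rewrite C0_scaleE normcM normc_real gtr0_norm//.
  rewrite mulrAC ler_pdivrMr// ler_pM2l ?divr_gt0//.
  by apply: le_trans (C0_sup_ge f x) _; rewrite lerDl mulr_ge0 ?ltW// divr_gt0.
rewrite mulrAC ler_pdivrMr// mul1r mulrC -ler_pdivlMr ?divr_gt0// => /le_trans; apply.
rewrite le_eqVlt; apply/orP; left; apply/eqP; rewrite /s.
by field; rewrite gt_eqF.
Qed.

Lemma Mb_is_predual :
  is_predual (fun (mu : Mb R S) (f : C0 R S) => Mb_integral mu f).
Proof.
split.
- exact: C0_complete.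
- by move=> f c mu nu; exact/Mb_integral_linear_measure/C0_bounded_borel.
- move=> mu c f g; rewrite Mb_integralD; first last.
  + exact: C0_bounded_borel.
  + exact: (C0_bounded_borel (c *: f)).
  by rewrite Mb_integralZ//; exact: C0_bounded_borel.
- move=> mu M /ge0_complexE[ME m0]; rewrite ME.
  move: (complex.Re M) m0 => m m0.
  rewrite Mb_normE lecR; split => [muM f|muM].
    rewrite C0_normE -rmorphM lecR.
    apply: le_trans (Mb_integral_le mu (C0_bounded_borel f) (C0_sup_ge f)) _.
    by rewrite mulrC ler_wpM2r ?C0_sup_ge0.
  apply: tvar_le_dual => // f; rewrite -lecR rmorphM.
  exact: muM.
- move=> phi phiL cphi; have [B B0 phiB] := C0_functional_bounded phiL cphi.
  have [mu muE] := complex_riesz S_hausdorff S_lcompact phiL B0 phiB.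
  by exists mu; apply/funext.
Qed.

(** A Cauchy filter of measures is viewed as one of functionals on [C0]. Its limit [l] is
    approximated by integrals in operator norm, hence is linear and bounded by [1 + tvar mu1 setT]
    for a [mu1] at distance at most 1, and [complex_riesz] makes it a measure. *)
Lemma Mb_complete : is_complete (Mb R S).
Proof.
apply: (@complete_of_evaluations _ _ (fun mu : Mb R S => tvar mu setT) (C0 R S)
  (fun f mu => Mb_integral mu f) (@C0_sup R S)).
- by [].
- exact: C0_sup_ge0.
- move=> f mu nu; rewrite addrC -scaleN1r Mb_integral_linear_measure.
    by rewrite mulN1r addrC.
  exact: C0_bounded_borel.
- move=> f mu; rewrite mulrC; apply: Mb_integral_le; first exact: C0_bounded_borel.
  exact: C0_sup_ge.
- by move=> mu e e0 mue; exact: tvar_le_dual.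
move=> l lP; have [mu1 lmu1] := lP 1 ltr01.
apply: (@complex_riesz _ _ S_hausdorff S_lcompact l (1 + tvar mu1 setT)).
- move=> c f g; apply/eqP; rewrite -subr_eq0; apply/eqP/normc_eq0_le => e e0.
  pose K := C0_sup (c *: f + g) + (normc c * C0_sup f + C0_sup g).
  have K0 : 0 < 1 + K.
    by rewrite ltr_pwDl// !addr_ge0 ?mulr_ge0 ?normc_ge0 ?C0_sup_ge0.
  have [mu lmu] := lP _ (divr_gt0 e0 K0); set d := e / _ in lmu.
  have muE : Mb_integral mu (c *: f + g) = c * Mb_integral mu f + Mb_integral mu g.
    rewrite Mb_integralD; first last.
    + exact: C0_bounded_borel.
    + exact: (C0_bounded_borel (c *: f)).
    by rewrite Mb_integralZ//; exact: C0_bounded_borel.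
  rewrite (_ : l (c *: f + g) - (c * l f + l g) =
      (l (c *: f + g) - Mb_integral mu (c *: f + g)) -
      (c * (l f - Mb_integral mu f) + (l g - Mb_integral mu g))); last first.
    by rewrite muE; ring.
  apply: (@le_trans _ _ (d * K)); last first.
    by rewrite /d mulrAC ler_pdivrMr// ler_pM2l// lerDr.
  apply: le_trans (le_normcD _ _) _; rewrite normcN /K [leRHS]mulrDr lerD//.
  apply: le_trans (le_normcD _ _) _; rewrite normcM [leRHS]mulrDr lerD//.
  by rewrite mulrCA ler_wpM2l ?normc_ge0.
- by rewrite addr_ge0// tvar_ge0.
- move=> f; rewrite -[l f](subrK (Mb_integral mu1 f)).
  apply: le_trans (le_normcD _ _) _; rewrite mulrDl lerD// [leRHS]mulrC.
  by apply: Mb_integral_le; [exact: C0_bounded_borel|exact: C0_sup_ge].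
Qed.

End predual.

(** * Parametric integrals and Fubini's theorem *)

Section parametric_integral.
Context (R : realType) (S T : ptopologicalType).
Hypothesis S_hausdorff : hausdorff_space S.
Variables (h : S -> T -> R[i]) (P : R).
Hypothesis h_continuous : forall s t (e : R), 0 < e -> exists A B,
  [/\ nbhs s A, nbhs t B &
    forall s' t', A s' -> B t' -> normc (h s t - h s' t') <= e].
Hypothesis h_le : forall s t, normc (h s t) <= P.

Let P_ge0 : 0 <= P.
Proof. exact: le_trans (normc_ge0 _) (h_le point point). Qed.

Lemma slicel_continuous t : continuous ((fun s => h s t) : S -> R[i]^o).
Proof.
apply/continuous_normcP => s e /(h_continuous s t)[A [B [sA tB AB]]].
by apply: filterS sA => s' As'; apply: AB => //; exact: nbhs_singleton.
Qed.

Lemma slicer_continuous s : continuous (h s : T -> R[i]^o).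
Proof.
apply/continuous_normcP => t e /(h_continuous s t)[A [B [sA tB AB]]].
by apply: filterS tB => t' Bt'; apply: AB => //; exact: nbhs_singleton.
Qed.

Lemma slicel_borel t : bounded_borel (fun s => h s t).
Proof. exact: (bounded_continuous_borel (@slicel_continuous t) (fun s => h_le s t)). Qed.

Lemma slicer_borel s : bounded_borel (h s).
Proof. exact: (bounded_continuous_borel (@slicer_continuous s) (h_le s)). Qed.

(** The tube lemma, through the near-covering form of compactness. *)
Lemma slice_uniform (K : set S) t (e : R) : compact K -> 0 < e ->
  \forall t' \near t, forall s, K s -> normc (h s t' - h s t) <= e.
Proof.
move=> /compact_near_coveringP kK e0; have e20 : 0 < e / 2 by rewrite divr_gt0.
apply: (kK T (nbhs t) (fun t' s => normc (h s t' - h s t) <= e)) => s Ks.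
have [A [B [sA tB AB]]] := h_continuous s t e20.
exists (A, B) => //= -[s' t'] /= [As' Bt'].
rewrite (_ : h s' t' - h s' t = (h s t - h s' t) - (h s t - h s' t')); last by ring.
apply: le_trans (le_normcD _ _) _; rewrite normcN (splitr e) lerD//; apply: AB => //.
exact: nbhs_singleton.
Qed.

Variable mu : Mb R S.

(** The kernel [h] will be [f (s * t)] with the variables in either order, so that both averages
    come from one construction. *)
Definition integral_slice t : R[i] := Mb_integral mu (fun s => h s t).

Lemma integral_slice_le t : normc (integral_slice t) <= P * tvar mu setT.
Proof. by apply: Mb_integral_le; [exact: slicel_borel|move=> s; exact: h_le]. Qed.

(** Stated for two arbitrary points, since [fubini_radon] compares [t] with a node [tau (q t)] that
    is close to [t] only through the values of [h] on [K]. The difference is at most [e] on [K] and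
    [2 P] off it. *)
Lemma integral_slice_osc (K : set S) t t' (e : R) : compact K ->
  (forall s, K s -> normc (h s t - h s t') <= e) -> 0 <= e ->
  tvar mu (setT `\` K) <= e ->
  normc (integral_slice t - integral_slice t') <= e * (tvar mu setT + 2 * P).
Proof.
move=> kK hK e0 muK.
have mK : measurable (K : set (borel S)) by exact: compact_borel.
rewrite /integral_slice -Mb_integralB; [|exact: slicel_borel..].
have P2 : 0 <= 2 * P by rewrite mulr_ge0.
apply: le_trans (@Mb_integral_le2 _ _ mu _ K e (2 * P) mK _ e0 P2 hK _) _.
- by apply: bounded_borelB; exact: slicel_borel.
- move=> s _; apply: le_trans (le_normcD _ _) _; rewrite normcN.
  by rewrite (_ : 2 * P = P + P) ?lerD//; ring.
- rewrite [leRHS]mulrDr lerD//; first by rewrite ler_wpM2l// tvar_subset.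
  by rewrite mulrC ler_wpM2r// -setTD.
Qed.

Lemma integral_slice_continuous : continuous (integral_slice : T -> R[i]^o).
Proof.
apply/continuous_normcP => t e e0.
have C0 : 0 < 1 + (tvar mu setT + 2 * P).
  by rewrite ltr_pwDl// addr_ge0 ?tvar_ge0// mulr_ge0.
have d0 := divr_gt0 e0 C0; set d := e / _ in d0.
have [K [kK _ Kd]] := tvar_inner mu measurableT d0.
apply: filterS (slice_uniform t kK d0) => t' tt'.
apply: le_trans (integral_slice_osc kK _ (ltW d0) (ltW Kd)) _.
  by move=> s Ks; rewrite normcB_sym tt'.
by rewrite /d mulrAC ler_pdivrMr// ler_pM2l// lerDr.
Qed.

Lemma integral_slice_borel : bounded_borel integral_slice.
Proof. exact: (bounded_continuous_borel integral_slice_continuous integral_slice_le). Qed.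

Hypothesis h_vanishes : forall (K : set S) (e : R), compact K -> 0 < e ->
  precompact [set t | exists2 s, K s & e <= normc (h s t)].

Lemma slicer_C0 s : (h s : T -> R[i]^o) \in @C0_pred R T.
Proof.
apply/asboolP; split => [|e e0]; first exact: slicer_continuous.
rewrite -precompact_closed; last exact: (@closed_normc_ge _ _ _ e (@slicer_continuous s)).
apply: precompact_subset (h_vanishes (@compact_set1 _ s) e0) => t /= et.
by exists s.
Qed.

Lemma integral_slice_C0 : (integral_slice : T -> R[i]^o) \in @C0_pred R T.
Proof.
apply/asboolP; split => [|e e0]; first exact: integral_slice_continuous.
(* If [normc (h s t) < d] on all of [K], the integral is at most [d * (tvar mu setT + P)]; the added
   1 makes this strictly less than [e]. *)
have C0 : 0 < 1 + (tvar mu setT + P) by rewrite ltr_pwDl// addr_ge0 ?tvar_ge0.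
have d0 := divr_gt0 e0 C0; set d := e / _ in d0.
have [K [kK _ Kd]] := tvar_inner mu measurableT d0.
have mK : measurable (K : set (borel S)) by exact: compact_borel.
rewrite -precompact_closed; last first.
  exact: (@closed_normc_ge _ _ _ e integral_slice_continuous).
apply: precompact_subset (h_vanishes kK d0) => t /= et.
apply: contrapT => nos; move: et; rewrite leNgt => /negP; apply.
apply: (@le_lt_trans _ _ (d * (tvar mu setT + P))); last first.
  by rewrite /d mulrAC ltr_pdivrMr// ltr_pM2l// ltrDr.
apply: le_trans (@Mb_integral_le2 _ _ mu _ K d P mK (slicel_borel t)
  (ltW d0) P_ge0 _ _) _.
- move=> s Ks; rewrite leNgt; apply/negP => ds; apply: nos; exists s => //.
  exact: ltW.
- by move=> s _; exact: h_le.
- rewrite [leRHS]mulrDr lerD//; first by rewrite ler_wpM2l ?tvar_subset// ltW.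
  by rewrite mulrC ler_wpM2r// -setTD ltW.
Qed.

End parametric_integral.

Section fubini.
Context (R : realType) (S T : ptopologicalType).
Hypothesis S_hausdorff : hausdorff_space S.
Hypothesis T_hausdorff : hausdorff_space T.
Variables (h : S -> T -> R[i]) (P : R).
Hypothesis h_continuous : forall s t (e : R), 0 < e -> exists A B,
  [/\ nbhs s A, nbhs t B &
    forall s' t', A s' -> B t' -> normc (h s t - h s' t') <= e].
Hypothesis h_le : forall s t, normc (h s t) <= P.

Let h_continuous_sym t s (e : R) : 0 < e -> exists B A,
  [/\ nbhs t B, nbhs s A &
    forall t' s', B t' -> A s' -> normc (h s t - h s' t') <= e].
Proof.
move=> /(h_continuous s t)[A [B [sA tB AB]]]; exists B, A; split => // t' s' Bt As.
exact: AB.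
Qed.

(** The cell of index [j] is the [j]-th open set minus the earlier ones; index [size ts] collects
    the points that no set covers. *)
Lemma find_borel (U : T -> set T) (ts : seq T) (j : nat) : (forall t, open (U t)) ->
  measurable ([set t | find (fun t0 => `[< U t0 t >]) ts = j] : set (borel T)).
Proof.
move=> oU; elim: ts j => [|t0 ts IH] j /=.
  case: j => [|j].
    by rewrite (_ : [set _ | _] = setT)//; apply/seteqP.
  by rewrite (_ : [set _ | _] = set0)//; apply/seteqP; split => t.
case: j => [|j].
  rewrite (_ : [set _ | _] = U t0); first exact: open_borel.
  by apply/seteqP; split => t /=; case: asboolP.
rewrite (_ : [set _ | _] =
    ~` U t0 `&` [set t | find (fun t0 => `[< U t0 t >]) ts = j]).
  by apply: measurableI => //; apply: measurableC; exact: open_borel.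
apply/seteqP; split => t /=; case: asboolP => // Ut; first by move=> [].
  by case.
by case=> _ ->.
Qed.

(** The measures live on the Borel sets of [S] and [T], and the Borel sets of
    [S * T] need not be generated by rectangles, so the product measure is not
    available. Instead [h s t] is replaced by [h s (tau (q t))], which is a step
    function of [t] and is uniformly close to [h] on a compact rectangle [K * L]
    carrying almost all the mass. *)
Lemma fubini_radon (mu : Mb R S) (nu : Mb R T) :
  Mb_integral nu (fun t => Mb_integral mu (fun s => h s t)) =
  Mb_integral mu (fun s => Mb_integral nu (fun t => h s t)).
Proof.
apply/eqP; rewrite -subr_eq0; apply/eqP/normc_eq0_le => e e0.
have P_ge0 : 0 <= P := le_trans (normc_ge0 _) (h_le point point).
have P2 : 0 <= 2 * P by rewrite mulr_ge0.
pose V := tvar mu setT; pose W := tvar nu setT.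
have V0 : 0 <= V by exact: tvar_ge0.
have W0 : 0 <= W by exact: tvar_ge0.
(* Each half bounds, in units of [d], the distance from one iterated integral to [Z]: its first term
   comes from the compact set in the outer variable, its second from the complement. *)
pose C := ((V + 2 * P) * W + 2 * (P * V)) + ((W + 2 * P) * V + 2 * (P * W)).
have C0 : 0 < 1 + C by rewrite ltr_pwDl// !(addr_ge0, mulr_ge0).
have d0 := divr_gt0 e0 C0; set d := e / _ in d0.
have [K [kK _ Kd]] := tvar_inner mu measurableT d0.
have [L [kL _ Ld]] := tvar_inner nu measurableT d0.
have mK : measurable (K : set (borel S)) by exact: compact_borel.
have mL : measurable (L : set (borel T)) by exact: compact_borel.
pose U t0 : set T := [set t | forall s, K s -> normc (h s t - h s t0) <= d]°.
have oU t0 : open (U t0) by exact: open_interior.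
have := kL; rewrite compact_cover => /(_ T L U (fun t _ => oU t))[t Lt|D _ LD].
  by exists t => //; exact: slice_uniform h_continuous _ _ _ kK d0.
pose ts : seq T := D.
pose f t := find (fun t0 => `[< U t0 t >]) ts.
have f_lt t : (f t < (size ts).+1)%N by rewrite ltnS find_size.
pose q t : 'I_(size ts).+1 := Ordinal (f_lt t).
(* The default [point] is reached only at points outside the cover of [L], where the crude bound
   applies. *)
pose tau (j : 'I_(size ts).+1) := nth point ts j.
have mq : borel_partition q.
  move=> j; rewrite (_ : q @^-1` _ = [set t | f t = j]); first exact: find_borel.
  by apply/seteqP; split => t /= => [<-//|fj]; exact: val_inj.
have tauP t : L t -> forall s, K s -> normc (h s t - h s (tau (q t))) <= d.
  move=> /LD[t0 /= Dt0 Ut0].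
  have : has (fun t0 => `[< U t0 t >]) ts by apply/hasP; exists t0 => //; exact/asboolP.
  by move=> /(nth_find point)/asboolP/interior_subset.
pose Phi := integral_slice h mu.
pose Psi s := Mb_integral nu (h s).
have Phi_borel : bounded_borel Phi.
  exact: (integral_slice_borel S_hausdorff h_continuous h_le).
have Psi_borel : bounded_borel Psi.
  exact: (@integral_slice_borel _ _ _ T_hausdorff (fun t s => h s t) _
    h_continuous_sym (fun t s => h_le s t)).
have sl t := slicel_borel h_continuous h_le t.
have sr s := slicer_borel h_continuous h_le s.
(* The common value of both iterated integrals of the step kernel: with a finite sum in [t], the
   interchange is mere linearity. *)
pose Z := \sum_j Phi (tau j) * nu (q @^-1` [set j]).
have Z1 : Mb_integral nu (fun t => Phi (tau (q t))) = Z.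
  by rewrite (Mb_integral_step nu (Phi \o tau)).
have st s : Mb_integral nu (fun t => h s (tau (q t))) =
    \sum_j nu (q @^-1` [set j]) * h s (tau j).
  rewrite (Mb_integral_step nu (h s \o tau))//.
  by apply: eq_bigr => j _; rewrite mulrC.
have st_borel : bounded_borel (fun s => Mb_integral nu (fun t => h s (tau (q t)))).
  by under eq_fun do rewrite st; apply: bounded_borel_sum => j; exact: bounded_borelZ.
have Z2 : Mb_integral mu (fun s => Mb_integral nu (fun t => h s (tau (q t)))) = Z.
  under eq_fun do rewrite st.
  rewrite Mb_integral_sum => [|j]; last exact: bounded_borelZ.
  by apply: eq_bigr => j _; rewrite Mb_integralZ// mulrC.
have X_Z : normc (Mb_integral nu Phi - Z) <= d * ((V + 2 * P) * W + 2 * (P * V)).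
  have bq : bounded_borel (fun t => Phi (tau (q t))).
    exact: (bounded_borel_step (Phi \o tau)).
  rewrite -Z1 -Mb_integralB//.
  apply: le_trans (@Mb_integral_le2 _ _ nu _ L (d * (V + 2 * P)) (2 * (P * V)) mL
    (bounded_borelB Phi_borel bq) _ _ _ _) _.
  - by rewrite mulr_ge0 ?addr_ge0// ltW.
  - by rewrite !mulr_ge0.
  - move=> t Lt; apply: (integral_slice_osc S_hausdorff h_continuous h_le kK _
      (ltW d0) (ltW Kd)).
    exact: tauP.
  - move=> t _; apply: le_trans (le_normcD _ _) _; rewrite normcN.
    rewrite (_ : 2 * (P * V) = P * V + P * V); last by ring.
    by rewrite lerD// (integral_slice_le h_continuous h_le).
  - rewrite [leRHS]mulrDr lerD//.
      by rewrite mulrA ler_wpM2l ?tvar_subset// mulr_ge0 ?addr_ge0// ltW.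
    by rewrite mulrC ler_wpM2r ?mulr_ge0// -setTD ltW.
have Y_Z : normc (Mb_integral mu Psi - Z) <= d * ((W + 2 * P) * V + 2 * (P * W)).
  rewrite -Z2 -Mb_integralB//.
  have hq s : bounded_borel (fun t => h s (tau (q t))).
    exact: (bounded_borel_step (h s \o tau)).
  apply: le_trans (@Mb_integral_le2 _ _ mu _ K (d * (W + 2 * P)) (2 * (P * W)) mK
    (bounded_borelB Psi_borel st_borel) _ _ _ _) _.
  - by rewrite mulr_ge0 ?addr_ge0// ltW.
  - by rewrite !mulr_ge0.
  - move=> s Ks; rewrite -Mb_integralB//.
    apply: le_trans (@Mb_integral_le2 _ _ nu _ L d (2 * P) mL
      (bounded_borelB (sr s) (hq s)) (ltW d0) P2 _ _) _.
    + by move=> t Lt; exact: tauP.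
    + move=> t _; apply: le_trans (le_normcD _ _) _; rewrite normcN.
      by rewrite (_ : 2 * P = P + P) ?lerD//; ring.
    + rewrite [leRHS]mulrDr lerD//; first by rewrite ler_wpM2l ?tvar_subset// ltW.
      by rewrite mulrC ler_wpM2r// -setTD ltW.
  - move=> s _; apply: le_trans (le_normcD _ _) _; rewrite normcN.
    rewrite (_ : 2 * (P * W) = P * W + P * W); last by ring.
    by rewrite lerD//; apply: Mb_integral_le.
  - rewrite [leRHS]mulrDr lerD//.
      by rewrite mulrA ler_wpM2l ?tvar_subset// mulr_ge0 ?addr_ge0// ltW.
    by rewrite mulrC ler_wpM2r ?mulr_ge0// -setTD ltW.
rewrite (_ : _ - _ = (Mb_integral nu Phi - Z) - (Mb_integral mu Psi - Z)); last first.
  by rewrite opprB addrA subrK.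
apply: le_trans (le_normcD _ _) _; rewrite normcN.
apply: le_trans (lerD X_Z Y_Z) _; rewrite -mulrDr -/C.
by rewrite /d mulrAC ler_pdivrMr// ler_pM2l// lerDr.
Qed.

End fubini.

(** * Convolution *)

Section convolution_algebra.
Context (R : realType) (S : topologicalSemigroupType).
Hypothesis S_hausdorff : hausdorff_space S.
Hypothesis S_lcompact : locally_compact [set: S].
Hypothesis S_quotients : forall F K : set S, compact F -> compact K ->
  precompact (set_divr F K) /\ precompact (set_divl K F).
Implicit Types (mu nu : Mb R S) (f : C0 R S).

(** The difference satisfies the dual bound with constant 0, so its norm vanishes by
    [tvar_le_dual]. *)
Lemma Mb_ext mu nu : (forall f, Mb_integral mu f = Mb_integral nu f) -> mu = nu.
Proof.
move=> mn; apply/eqP; rewrite -subr_eq0; apply/eqP; apply: Mb_norm0_eq0.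
congr (real_complex _ _); apply/eqP; rewrite eq_le tvar_ge0 andbT.
apply: tvar_le_dual => // f; rewrite mul0r addrC -scaleN1r.
rewrite Mb_integral_linear_measure; last exact: C0_bounded_borel.
by rewrite mn mulN1r addNr normc0.
Qed.

Lemma C0_mul_continuous f s t (e : R) : 0 < e -> exists A B,
  [/\ nbhs s A, nbhs t B & forall s' t', A s' -> B t' ->
    normc (f (s * t)%g - f (s' * t')%g) <= e].
Proof.
move=> e0; have /continuous_normcP/(_ _ e e0) := @C0_continuous _ _ f.
move=> /(_ (s * t)%g)/(@mulg_continuous S (s, t))[[A B] [/= sA tB] AB].
by exists A, B; split => // s' t' As' Bt'; exact: (AB (s', t')).
Qed.

Lemma C0_mul_continuous_sym f t s (e : R) : 0 < e -> exists A B,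
  [/\ nbhs t A, nbhs s B & forall t' s', A t' -> B s' ->
    normc (f (s * t)%g - f (s' * t')%g) <= e].
Proof.
move=> /(C0_mul_continuous f s t)[A [B [sA tB AB]]]; exists B, A.
by split => // t' s' Bt As; exact: AB.
Qed.

Lemma C0_divl_precompact f (K : set S) (e : R) : compact K -> 0 < e ->
  precompact [set t | exists2 s, K s & e <= normc (f (s * t)%g)].
Proof.
move=> kK e0; have [_] := S_quotients (@C0_vanishes _ _ f e e0) kK.
by apply: precompact_subset => t [s Ks es]; exists s.
Qed.

Lemma C0_divr_precompact f (K : set S) (e : R) : compact K -> 0 < e ->
  precompact [set s | exists2 t, K t & e <= normc (f (s * t)%g)].
Proof.
move=> kK e0; have [+ _] := S_quotients (@C0_vanishes _ _ f e e0) kK.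
by apply: precompact_subset => s [t Kt es]; exists t.
Qed.

Let f_le f s t : normc (f (s * t)%g) <= C0_sup f.
Proof. exact: C0_sup_ge. Qed.

Definition left_average mu f : C0 R S := MkC0
  (integral_slice_C0 S_hausdorff (C0_mul_continuous f) (f_le f) mu
    (@C0_divl_precompact f)).

Definition right_average mu f : C0 R S := MkC0
  (integral_slice_C0 S_hausdorff (C0_mul_continuous_sym f)
    (fun t s => f_le f s t) mu (@C0_divr_precompact f)).

(** It belongs to [C0] by the quotient condition for the one-point set [{t}]; the convolution
    identity, which is stated on [C0], can then be applied to it in [convA]. *)
Definition right_translate t f : C0 R S := MkC0
  (slicer_C0 (C0_mul_continuous_sym f) (@C0_divr_precompact f) t).

Lemma left_average_le mu f t :
  normc (left_average mu f t) <= C0_sup f * tvar mu setT.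
Proof. exact: (integral_slice_le (C0_mul_continuous f) (f_le f) mu t). Qed.

Lemma left_averageD mu (c : R[i]) f g t :
  left_average mu (c *: f + g) t = c * left_average mu f t + left_average mu g t.
Proof.
have bf k : bounded_borel (fun s => (k : C0 R S) (s * t)%g).
  exact: (slicel_borel (C0_mul_continuous k) (f_le k)).
rewrite -[LHS]/(Mb_integral mu (fun s => c * f (s * t)%g + g (s * t)%g)).
by rewrite Mb_integralD ?Mb_integralZ//; exact: bounded_borelZ.
Qed.

Lemma convolution_exists mu nu : exists lambda, is_convolution mu nu lambda.
Proof.
apply: (@complex_riesz _ _ S_hausdorff S_lcompact
  (fun f => Mb_integral nu (left_average mu f)) (tvar mu setT * tvar nu setT)).
- move=> c f g; rewrite -Mb_integralZ; last exact: C0_bounded_borel.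
  rewrite -Mb_integralD; last 2 first.
  + exact/bounded_borelZ/C0_bounded_borel.
  + exact: C0_bounded_borel.
  by congr Mb_integral; apply/funext => t; rewrite left_averageD.
- by rewrite mulr_ge0 ?tvar_ge0.
- move=> f; rewrite mulrAC [X in X * _]mulrC.
  by apply: Mb_integral_le; [exact: C0_bounded_borel|exact: left_average_le].
Qed.

Variable conv : Mb R S -> Mb R S -> Mb R S.
Hypothesis convP : forall mu nu, is_convolution mu nu (conv mu nu).

Let convE mu nu f : Mb_integral (conv mu nu) f = Mb_integral nu (left_average mu f).
Proof. exact: convP. Qed.

(** At [t], the average of [f] over [conv a b] is the integral of a right translate of [f], to which
    the definition of [conv a b] applies. Both sides become a triple integral in the same order,
    with [f] evaluated at the two bracketings of one product. *)
Lemma convA : associative conv.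
Proof.
move=> a b c; apply: Mb_ext => f; rewrite !convE.
congr Mb_integral; apply/funext => t.
transitivity (Mb_integral (conv a b) (right_translate t f)); last by [].
rewrite convE; congr Mb_integral; apply/funext => s'.
by congr Mb_integral; apply/funext => s; congr (C0_fun f _); exact: mulgA.
Qed.

Lemma conv_linearl nu : linear (conv^~ nu).
Proof.
move=> c a b; apply: Mb_ext => f.
rewrite Mb_integral_linear_measure; last exact: C0_bounded_borel.
rewrite !convE -Mb_integralZ; last exact: C0_bounded_borel.
rewrite -Mb_integralD; last 2 first.
- exact/bounded_borelZ/C0_bounded_borel.
- exact: C0_bounded_borel.
congr Mb_integral; apply/funext => t.
apply: Mb_integral_linear_measure.
exact: (slicel_borel (C0_mul_continuous f) (f_le f)).
Qed.

Lemma conv_linearr mu : linear (conv mu).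
Proof.
move=> c a b; apply: Mb_ext => f.
have bf := C0_bounded_borel (left_average mu f).
by rewrite Mb_integral_linear_measure ?convE ?Mb_integral_linear_measure//;
  exact: C0_bounded_borel.
Qed.

Lemma conv_norm mu nu : `|conv mu nu| <= `|mu| * `|nu|.
Proof.
rewrite !Mb_normE -(rmorphM (real_complex R)) lecR.
apply: tvar_le_dual => // [f|]; last by rewrite mulr_ge0 ?tvar_ge0.
rewrite convE mulrAC [X in X * _]mulrC.
by apply: Mb_integral_le; [exact: C0_bounded_borel|exact: left_average_le].
Qed.

(** The convolution formula integrates the second factor [mu] last, whereas a functional of [nu]
    requires it inside: this is the one place where the order of integration is reversed. *)
Lemma conv_left_action mu f :
  (fun nu => Mb_integral (conv nu mu) f) =
  (fun nu => Mb_integral nu (right_average mu f)).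
Proof.
apply/funext => nu; rewrite convE.
exact: (fubini_radon S_hausdorff S_hausdorff (C0_mul_continuous f) (f_le f)).
Qed.

End convolution_algebra.

Theorem proposition3p1 (R : realType) (S : topologicalSemigroupType)
  (S_hausdorff : hausdorff_space S) (S_lcompact : locally_compact [set: S])
  (S_quotients : forall F K : set S, compact F -> compact K ->
    precompact (set_divr F K) /\ precompact (set_divl K F)) :
  exists conv : Mb R S -> Mb R S -> Mb R S,
    (forall mu nu : Mb R S, is_convolution mu nu (conv mu nu)) /\
    is_dual_Banach_algebra conv
      (fun (mu : Mb R S) (f : C0 R S) => Mb_integral mu f).
Proof.
have /choice[conv' conv'P] : forall mn : Mb R S * Mb R S,
    exists lambda, is_convolution mn.1 mn.2 lambda.
  by move=> [mu nu]; exact: convolution_exists.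
pose conv mu nu := conv' (mu, nu).
have convP mu nu : is_convolution mu nu (conv mu nu) := conv'P (mu, nu).
exists conv; split => //; split.
- split.
  + exact: Mb_complete.
  + exact: (convA S_hausdorff S_lcompact S_quotients convP).
  + exact: (conv_linearl S_hausdorff S_lcompact S_quotients convP).
  + exact: (conv_linearr S_hausdorff S_lcompact S_quotients convP).
  + exact: (conv_norm S_hausdorff S_lcompact S_quotients convP).
- exact: Mb_is_predual.
- move=> mu _ [f _ <-]; exists (right_average S_hausdorff S_quotients mu f) => //.
  exact/esym/conv_left_action.
- move=> mu _ [f _ <-]; exists (left_average S_hausdorff S_quotients mu f) => //.
  by apply/funext => nu; exact/esym/convP.
Qed.
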